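(* Let $(X,X^+)$ be an ordered Banach space with total cone and let $A: X \supseteq \operatorname{dom}(A) \to X$ be a resolvent positive linear operator. Assume that $s_{\mathrm{ess}}(A) < s(A)$. Then $s(A) < \infty$, the number $s(A)$ is an eigenvalue of $A$, and there exists a corresponding eigenvector in $X^+$. If $A$ is, in addition, densely defined, then $s(A)$ is also an eigenvalue of the dual operator $A'$ and there exists a corresponding eigenvector in $(X')^+$.
   Context: An ordered Banach space $(X,X^+)$ is a real Banach space $X$ together with a closed convex cone $X^+$ (so $X^+ + X^+ \subseteq X^+$ and $[0,\infty)X^+ \subseteq X^+$) with $X^+ \cap (-X^+) = \{0\}$. The cone is total if $X^+ - X^+$ is dense in $X$. $(X')^+$ denotes the set of $x' \in X'$ with $\langle x',x\rangle \ge 0$ for all $x \in X^+$. A bounded linear operator $T$ on $X$ is positive if $TX^+ \subseteq X^+$. Spectral notions for a closed operator $A$ on $X$ (spectrum $\sigma(A)$, essential spectrum, resolvent set $\rho(A)$, resolvent $\mathcal{R}(\lambda,A)=(\lambda-A)^{-1}$) refer to the canonical extension of $A$ to a complexification of $X$. $A$ is resolvent positive if there is $\omega\in\mathbb{R}$ such that $(\omega,\infty)\subseteq\rho(A)$ and $\mathcal{R}(\lambda,A)$ is positive for each $\lambda\in(\omega,\infty)$. The spectral bound is $s(A) := \sup\{\operatorname{Re}\lambda:\lambda\in\sigma(A)\}\in[-\infty,\infty]$. The essential spectrum $\sigma_{\mathrm{ess}}(A)$ is the set of $\lambda\in\mathbb{C}$ such that $\lambda\,\mathrm{id} - A$, as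 a bounded operator from $\operatorname{dom}(A)$ (with the graph norm) to the underlying Banach space, is not Fredholm (Fredholm: finite-dimensional kernel and range of finite codimension). The essential spectral bound is $s_{\mathrm{ess}}(A) := \sup\{\operatorname{Re}\lambda:\lambda\in\sigma_{\mathrm{ess}}(A)\}\in[-\infty,\infty]$. Convention: $\sup\emptyset=-\infty$. *)

(* Defs.v *)
From HB Require Import structures.
From mathcomp Require Import all_boot all_order all_algebra.
From mathcomp Require Import complex.
From mathcomp Require Import all_classical all_reals all_analysis.

Set Implicit Arguments.
Unset Strict Implicit.
Unset Printing Implicit Defensive.

Import Order.TTheory GRing.Theory Num.Theory.
Import numFieldNormedType.Exports.

Local Open Scope classical_set_scope.
Local Open Scope ring_scope.
Local Open Scope complex_scope.

(* The values of [op_fun] outside [op_dom] are irrelevant: every notion below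
   only evaluates an operator on its domain. *)
Record operator (K : numFieldType) (E : lmodType K) := Operator {
  op_dom : set E;
  op_fun :> E -> E;
  op_dom0 : op_dom 0;
  op_domP : forall a u v, op_dom u -> op_dom v -> op_dom (a *: u + v);
  op_linear : forall a u v, op_dom u -> op_dom v ->
    op_fun (a *: u + v) = a *: op_fun u + op_fun v
}.

Section LinearAlgebra.
Context (K : numFieldType) (E : lmodType K).
Implicit Types (A : operator E) (l : K) (V : set E).

Definition lin_span (s : seq E) : set E :=
  [set v | exists c : 'I_(size s) -> K, v = \sum_(i < size s) c i *: s`_i].

Definition finite_dimensional V := exists s : seq E, V = lin_span s.

Definition finite_codimensional V :=
  exists s : seq E, forall x, exists2 v, V v & lin_span s (x - v).

Definition op_ker A : set E := [set u | op_dom A u /\ A u = 0].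

Definition op_range A : set E := A @` op_dom A.

(* Being Fredholm only involves the kernel and the range, so the graph norm
   on the domain does not enter. *)
Definition fredholm A :=
  finite_dimensional (op_ker A) /\ finite_codimensional (op_range A).

Definition op_eigenvector A l (u : E) := [/\ op_dom A u, u != 0 & A u = l *: u].

Definition op_eigenvalue A l := exists u, op_eigenvector A l u.

Section Shift.
Context (l : K) (A : operator E).

Lemma shift_linear a u v : op_dom A u -> op_dom A v ->
  l *: (a *: u + v) - A (a *: u + v) = a *: (l *: u - A u) + (l *: v - A v).
Proof.
move=> du dv; rewrite op_linear// !scalerDr scalerN !scalerA [a * l]mulrC.
by rewrite opprD addrACA.
Qed.

Definition shift : operator E :=
  @Operator K E (op_dom A) (fun u => l *: u - A u)
    (op_dom0 A) (@op_domP _ _ A) shift_linear.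

End Shift.

(* the inverse of l id - A (constantly 0 off the range of l id - A) *)
Definition resolvent l A (f : E) : E :=
  xget 0 [set u | op_dom A u /\ shift l A u = f].

End LinearAlgebra.

(* The continuity of the resolvent is required explicitly.  Hence an operator
   on a Banach space with nonempty resolvent set is closed, and for a closed
   operator the continuity is automatic (closed graph theorem). *)
Definition resolvent_set (K : numFieldType) (E : preTopologicalLmodType K)
    (A : operator E) : set K :=
  [set l | set_bij (op_dom A) setT (shift l A) /\ continuous (resolvent l A)].

(* The complexification of X is X * X with (x, y) standing for x + iy.  It
   carries the product topology, which is the topology of each of the
   (pairwise equivalent) norms used on a complexification. *)
Definition complexification (X : Type) : Type := (X * X)%type.

HB.instance Definition _ (X : choiceType) :=
  Choice.copy (complexification X) (X * X)%type.
HB.instance Definition _ (X : zmodType) :=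
  GRing.Zmodule.copy (complexification X) (X * X)%type.
HB.instance Definition _ (X : topologicalType) :=
  Topological.copy (complexification X) (X * X)%type.

Section ComplexScaling.
Context (R : realType) (X : lmodType R).
Local Notation XC := (complexification X).

Definition cscale (l : R[i]) (z : XC) : XC :=
  let: a +i* b := l in (a *: z.1 - b *: z.2, a *: z.2 + b *: z.1).

Lemma cscaleA a b (z : XC) : cscale a (cscale b z) = cscale (a * b) z.
Proof.
case: a b z => [a1 a2] [b1 b2] [x y]; congr (_, _) => /=.
- rewrite !scalerDr !scalerN scalerBl scalerDl !scalerA !opprD.
  by rewrite -!addrA; congr (_ + _); rewrite addrA addrC.
- rewrite !scalerDr !scalerN scalerBl scalerDl !scalerA.
  by rewrite -!addrA; congr (_ + _); rewrite addrA [LHS]addrC.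
Qed.

Lemma cscale1 : left_id 1 cscale.
Proof. by case=> x y; rewrite /cscale /= !scale1r !scale0r subr0 addr0. Qed.

Lemma cscaleDr : right_distributive cscale +%R.
Proof.
case=> a b [x y] [x' y']; congr (_, _) => /=.
- by rewrite !scalerDr opprD addrACA.
- by rewrite !scalerDr addrACA.
Qed.

Lemma cscaleDl (z : XC) : {morph cscale^~ z : a b / a + b}.
Proof.
case: z => [x y] [a b] [c d]; congr (_, _) => /=.
- by rewrite !scalerDl opprD addrACA.
- by rewrite !scalerDl addrACA.
Qed.

HB.instance Definition _ := GRing.Zmodule_isLmodule.Build R[i] XC
  cscaleA cscale1 cscaleDr cscaleDl.

End ComplexScaling.

HB.instance Definition _ (R : realType) (X : preTopologicalLmodType R) :=
  Topological.on (complexification X).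

Section Complexify.
Context (R : realType) (X : lmodType R) (A : operator X).
Local Notation XC := (complexification X).

Let dom : set XC := [set z | op_dom A z.1 /\ op_dom A z.2].
Let fn (z : XC) : XC := (A z.1, A z.2).

Lemma op_domD u v : op_dom A u -> op_dom A v -> op_dom A (u + v).
Proof. by move=> du dv; rewrite -[u]scale1r; apply: op_domP. Qed.

Lemma op_domZ a u : op_dom A u -> op_dom A (a *: u).
Proof.
by move=> du; rewrite -[_ *: _]addr0; apply: op_domP => //; exact: op_dom0.
Qed.

Lemma op_funD u v : op_dom A u -> op_dom A v -> A (u + v) = A u + A v.
Proof.
by move=> du dv; rewrite -[u in LHS]scale1r op_linear// scale1r.
Qed.

Lemma op_fun0 : A 0 = 0.
Proof.
have d0 := op_dom0 A; apply: (addIr (A 0)).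
by rewrite -op_funD// addr0 add0r.
Qed.

Lemma op_funZ a u : op_dom A u -> A (a *: u) = a *: A u.
Proof.
move=> du; rewrite -[_ *: u]addr0 op_linear ?op_fun0 ?addr0//.
exact: op_dom0.
Qed.

Lemma complexify_dom0 : dom 0.
Proof. by split; exact: op_dom0. Qed.

Lemma complexify_domP (l : R[i]) u v : dom u -> dom v -> dom (l *: u + v).
Proof.
case: l => a b [du1 du2] [dv1 dv2]; split => /=.
- rewrite -scaleNr; apply: op_domD => //.
  by apply: op_domD; apply: op_domZ.
- by apply: op_domD => //; apply: op_domD; apply: op_domZ.
Qed.

Lemma complexify_linear (l : R[i]) u v : dom u -> dom v ->
  fn (l *: u + v) = l *: fn u + fn v.
Proof.
case: l => a b [du1 du2] [dv1 dv2]; rewrite /fn; congr (_, _) => /=.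
- rewrite -!scaleNr !op_funD ?op_funZ//.
  + exact: op_domZ.
  + exact: op_domZ.
  + by apply: op_domD; apply: op_domZ.
- rewrite !op_funD ?op_funZ//.
  + exact: op_domZ.
  + exact: op_domZ.
  + by apply: op_domD; apply: op_domZ.
Qed.

(* the canonical extension x + iy |-> Ax + iAy *)
Definition complexify : operator (complexification X : lmodType R[i]) :=
  Operator complexify_dom0 complexify_domP complexify_linear.

End Complexify.

Section SpectralBounds.
Context (R : realType) (X : normedModType R) (A : operator X).

Definition rho : set R[i] := resolvent_set (complexify A).

Definition spectrum : set R[i] := ~` rho.

Definition essential_spectrum : set R[i] :=
  [set l | ~ fredholm (shift l (complexify A))].

Definition spectral_bound : \bar R :=
  ereal_sup [set (complex.Re l)%:E | l in spectrum].

Definition essential_spectral_bound : \bar R :=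
  ereal_sup [set (complex.Re l)%:E | l in essential_spectrum].

End SpectralBounds.

Section OrderedBanach.
Context (R : realType) (X : normedModType R).
Implicit Types (P : set X) (A : operator X).

Definition is_cone P := [/\ closed P,
  forall x y, P x -> P y -> P (x + y),
  forall (a : R) x, 0 <= a -> P x -> P (a *: x) &
  P `&` [set x | P (- x)] = [set 0]].

Definition total_cone P := dense [set x - y | x in P & y in P].

Definition positive_map P (T : X -> X) := forall x, P x -> P (T x).

(* For real l in [rho A], the resolvent of A on X is the restriction to X of
   the resolvent of the complexification of A. *)
Definition resolvent_positive P A := exists w : R, forall l : R, w < l ->
  rho A l%:C /\ positive_map P (resolvent l A).

Definition densely_defined A := dense (op_dom A).

End OrderedBanach.

Section Dual.
Context (R : realType) (X : normedModType R).

Definition is_functional : {pred X -> R} :=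
  [pred f | `[< linear (f : X -> R^o) /\ continuous f >]].

Lemma is_functional_submod : submod_closed is_functional.
Proof.
split=> [|a f g].
  rewrite inE; split=> [b x y|x]; last exact: cst_continuous.
  by rewrite scaler0 addr0.
rewrite !inE => -[lf cf] [lg cg]; split=> [b x y|x].
  change (a * f (b *: x + y) + g (b *: x + y) =
    b * (a * f x + g x) + (a * f y + g y)).
  rewrite (lf b x y) (lg b x y).
  change (a * (b * f x + f y) + (b * g x + g y) =
    b * (a * f x + g x) + (a * f y + g y)).
  by rewrite !mulrDr mulrCA addrACA.
by apply: cvgD; [apply: cvgZr; exact: cf | exact: cg].
Qed.

HB.instance Definition _ :=
  GRing.isSubmodClosed.Build R (X -> R) is_functional is_functional_submod.

Record dual_space := Dual { dual_fun :> X -> R; dualP : dual_fun \in is_functional }.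

HB.instance Definition _ := [isSub for dual_fun].
HB.instance Definition _ := [Choice of dual_space by <:].
HB.instance Definition _ := [SubChoice_isSubLmodule of dual_space by <:].

Definition dual_cone (P : set X) : set dual_space :=
  [set f : dual_space | forall x, P x -> 0 <= f x].

End Dual.

Section DualOperator.
Context (R : realType) (X : normedModType R) (A : operator X).
Hypothesis dA : densely_defined A.
Local Notation X' := (dual_space X).

Let adj (f g : X') := forall x, op_dom A x -> f (A x) = g x.
Let dom : set X' := [set f | exists g, adj f g].
Let fn (f : X') : X' := xget 0 [set g | adj f g].

Lemma adj_uniq f g h : adj f g -> adj f h -> g = h.
Proof.
move=> fg fh; apply: val_inj; apply/funext => x /=.
have cg : continuous g by have := dualP g; rewrite inE => -[].
have ch : continuous h by have := dualP h; rewrite inE => -[].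
apply: contrapT => /eqP; rewrite -subr_eq0 => ghx.
have cgh : continuous (fun x => g x - h x).
  by move=> y; apply: cvgB; [exact: cg | exact: ch].
have oU : open [set y | g y - h y != 0].
  apply: (open_comp (f := fun x => g x - h x) (D := [set t | t != 0])).
    by move=> y _; exact: cgh.
  exact: open_neq.
have [|y [/= + dy]] := dA _ oU; first by exists x.
by rewrite -(fg _ dy) -(fh _ dy) subrr eqxx.
Qed.

Lemma fnE f g : adj f g -> fn f = g.
Proof.
move=> fg; rewrite /fn; case: xgetP => [h _ fh|/(_ g)//].
exact: adj_uniq fh fg.
Qed.

Lemma adj0 : adj 0 0.
Proof. by []. Qed.

Lemma adjP a f f' g g' : adj f g -> adj f' g' -> adj (a *: f + f') (a *: g + g').
Proof.
move=> fg fg' x dx.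
change (a * f (A x) + f' (A x) = a * g x + g' x).
by rewrite fg// fg'.
Qed.

Lemma dual_dom0 : dom 0.
Proof. by exists 0; exact: adj0. Qed.

Lemma dual_domP a f g : dom f -> dom g -> dom (a *: f + g).
Proof. by case=> f' ff' [g' gg']; exists (a *: f' + g'); exact: adjP. Qed.

Lemma dual_linear a f g : dom f -> dom g -> fn (a *: f + g) = a *: fn f + fn g.
Proof.
case=> f' ff' [g' gg'].
by rewrite (fnE ff') (fnE gg') (fnE (adjP a ff' gg')).
Qed.

(* A' f is the unique g with f (A x) = g x on the domain of A. *)
Definition dual_operator : operator (X' : lmodType R) :=
  Operator dual_dom0 dual_domP dual_linear.

End DualOperator.

(* Main.v *)
Require Import Defs.
From HB Require Import structures.
From mathcomp Require Import all_boot all_order all_algebra.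
From mathcomp Require Import complex ring lra.
From mathcomp Require Import all_classical all_reals all_analysis.

(** Fix a real [m] to the right of the spectrum, so that the resolvent
    [T] of [A] at [m] is a bounded positive operator.  The map
    [l |-> 1 / (m - l)] carries spectral and Fredholm properties of [l - A] to
    those of [z - T].  It maps the disc about [m] of radius [1 / t] to the region
    [|z| > t], and such discs with a fixed leftmost point exhaust a half-plane as
    [m] grows.  The statement thus becomes one of Perron-Frobenius type about
    the bounded operator [T], at points where [z - T] is Fredholm.

    Two ideas carry the proof for [T].  The first replaces the leading Laurent
    coefficient at a pole ([resolvent_blowup]).  Suppose that [t - T] is
    invertible for all [t > r], and that [r - T] is Fredholm but not invertible.
    The open mapping theorem bounds the norm of the inverse of [t - T], up to a
    constant, by its values on the finitely many vectors that complement the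
    range of [r - T]; call [a t] this bound, which tends to infinity.  The
    vectors [(t - T)^-1 x / a t] are bounded and [r - T] sends them to something
    that tends to 0, so they converge along an ultrafilter, because the kernel
    of [r - T] is finite-dimensional and its range is closed.  The limit is a
    nonzero bounded operator [C] with [T C = C T = r C].  If [T] is positive
    then so are the [(t - T)^-1] for [t > r], and hence so is [C]
    ([positive_leading_coefficient]): a vector [C x <> 0] with [x] in the cone is
    an eigenvector.  Hahn-Banach gives a positive functional [f] with
    [f (C x) > 0], and [f o C] is an eigenvector of the dual operator.

    The second idea shows that the top of the spectrum is attained on the real
    axis ([rotated_inverse]).  Let [w] be a complex number of modulus 1.  On [X * XC], with [XC] the complexification,
    the operator [(x, z) |-> (T x, w T z)] preserves the closed cone of those
    [(x, z)] with [x + Re (u z)] in [P] for all [u] of modulus 1.  This cone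
    contains [(x, x)] for [x] in [P].  Positivity of its resolvent propagates
    from large [t] down to [r] ([scalar_sub_inverse_preserves]).  If [t - T] is
    invertible for all [t >= r] while [r - w T] is not, the blow-up of
    [(t - w T)^-1] gives a limit [C <> 0] such that [(0, C x)] lies in the cone
    for all [x] in [P], as the first component stays bounded before it is
    divided by [a t].  Then [Re (u C x)] is in [P] and [- P] for each [u], so
    that [C] vanishes on [P], and on the whole space because [P] is total.

    Boundedness, invertibility and the Fredholm property survive when complex
    scalars are forgotten, so all this is done in real Banach spaces, with
    [X * X] as the complexification and [rot c d] as multiplication by
    [c + i d]. *)

Set Implicit Arguments.
Unset Strict Implicit.
Unset Printing Implicit Defensive.

Import Order.TTheory GRing.Theory Num.Theory.
Import numFieldNormedType.Exports.
Local Open Scope classical_set_scope.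
Local Open Scope ring_scope.
Local Open Scope complex_scope.

(** * Bounded linear maps and the open mapping theorem *)

Definition bounded_by (R : realType) (V W : normedModType R) (M : R)
    (f : V -> W) := forall x, `|f x| <= M * `|x|.

Definition blin (R : realType) (V W : normedModType R) (f : V -> W) :=
  linear f /\ exists M, bounded_by M f.

Section BoundedLinear.
Context (R : realType) (V W : normedModType R) (f : V -> W).
Hypothesis lf : linear f.

Let f' : {linear V -> W} := HB.pack f (GRing.isLinear.Build _ _ _ _ _ lf).

Lemma lin0 : f 0 = 0. Proof. exact: (linear0 f'). Qed.
Lemma linD x y : f (x + y) = f x + f y. Proof. exact: (linearD f'). Qed.
Lemma linB x y : f (x - y) = f x - f y. Proof. exact: (linearB f'). Qed.
Lemma linN x : f (- x) = - f x. Proof. exact: (linearN f'). Qed.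
Lemma linZ a x : f (a *: x) = a *: f x. Proof. exact: (linearZ_LR f'). Qed.
Lemma lin_sum I (r : seq I) (P : pred I) (F : I -> V) :
  f (\sum_(i <- r | P i) F i) = \sum_(i <- r | P i) f (F i).
Proof. exact: (linear_sum f'). Qed.

Lemma lin_bounded_continuous : (exists M, bounded_by M f) -> continuous f.
Proof.
move=> [M fM]; apply: (@bounded_linear_continuous _ _ _ f').
apply/linear_boundedP; near=> r => x.
by rewrite (le_trans (fM x))// ler_wpM2r//; near: r; exact: nbhs_pinfty_ge.
Unshelve. all: by end_near. Qed.

Lemma lin_continuous_bounded : continuous f ->
  exists2 M, 0 < M & bounded_by M f.
Proof.
move=> cf; have /linear_boundedP/pinfty_ex_gt0[M M0 fM] :
  bounded_near f' (nbhs 0) by exact/linear_bounded_continuous.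
by exists M.
Qed.

End BoundedLinear.

Section BlinTheory.
Context (R : realType).
Implicit Types V W : normedModType R.

Lemma blin_linear V W (f : V -> W) : blin f -> linear f. Proof. by case. Qed.

Lemma blin_continuous V W (f : V -> W) : blin f -> continuous f.
Proof. by case; exact: lin_bounded_continuous. Qed.

Lemma blin_bound V W (f : V -> W) : blin f -> exists2 M, 0 < M & bounded_by M f.
Proof.
by move=> bf; apply: lin_continuous_bounded (blin_continuous bf); case: bf.
Qed.

Lemma continuous_blin V W (f : V -> W) : linear f -> continuous f -> blin f.
Proof.
by move=> lf cf; split=> //; have [M _ fM] := lin_continuous_bounded lf cf; exists M.
Qed.

End BlinTheory.

Section ProductComplete.
Context (R : realType) (X Y : completeNormedModType R).

HB.instance Definition _ := Pointed.on (X * Y)%type.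

Lemma prod_cauchy_cvg (F : set_system (X * Y)%type) :
  ProperFilter F -> cauchy F -> cvg F.
Proof.
move=> FF cF.
have c1 : cvg (fst @ F).
  apply: cauchy_cvg; apply/cauchyP => e e0.
  have /cauchyP cF' := cF; have {cF'}[p Fp] := cF' e e0.
  by exists p.1; apply: (@filterS _ F _ _ _ _ Fp) => -[a b] [].
have c2 : cvg (snd @ F).
  apply: cauchy_cvg; apply/cauchyP => e e0.
  have /cauchyP cF' := cF; have {cF'}[p Fp] := cF' e e0.
  by exists p.2; apply: (@filterS _ F _ _ _ _ Fp) => -[a b] [].

apply/cvg_ex; exists (lim (fst @ F), lim (snd @ F)).
have c12 := cvg_pair c1 c2.
by move=> A /c12; apply: (@filterS _ F) => -[].
Qed.

HB.instance Definition _ :=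
  Uniform_isComplete.Build (X * Y)%type prod_cauchy_cvg.

End ProductComplete.


Section OpenMapping.
Context (R : realType) (V W : completeNormedModType R) (f : V -> W).
Hypotheses (bf : blin f) (sf : forall w, exists v, f v = w).

(** By Baire, the closure of the image of some ball has an interior point; by
    symmetry and convexity that closure then contains a ball around 0.  Scaling,
    every vector has a controlled preimage up to half of its norm. *)
Let approximate_preimage :
  exists2 K, 0 < K & forall w, exists v, `|v| <= K * `|w| /\ `|w - f v| <= 2^-1 * `|w|.
Proof.
have lf := blin_linear bf.
pose F (n : nat) : set W := ~` closure (f @` [set v | `|v| < n%:R]).
have [n ndF] : exists n, ~ dense (F n).
  apply/existsNP => dF.
  have dI : dense (\bigcap_n F n).
    apply: Baire => n; split; last exact: dF.
    by apply: closed_openC; exact: closed_closure.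
  have [|w [_ Fw]] := dI setT _ openT; first by exists 0.
  have [v vw] := sf w.
  apply: (Fw (Num.truncn `|v|).+1) => //; apply: subset_closure; exists v => //=.
  exact: truncnS_gt.
have [w0 [e e0 w0e]] : exists w0 : W, exists2 e : R, 0 < e &
    forall w, `|w - w0| < e -> closure (f @` [set v | `|v| < n%:R]) w.
  move/existsNP : ndF => [D /not_implyP[[w0 Dw0] /not_implyP[oD]]] H.
  have /nbhs_ballP[e /= e0 eD] : nbhs w0 D by exact: open_nbhs_nbhs.
  exists w0, e => // w we; apply: contrapT => Cw; apply: H; exists w; split => //.
  by apply: eD; rewrite -ball_normE /= distrC.
have approx (w : W) (d : R) : `|w - w0| < e -> 0 < d ->
    exists2 v, `|v| < n%:R & `|w - f v| < d.
  move=> /w0e cw d0; have [_ [[v vn <-]]] := cw _ (nbhsx_ballx w d d0).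
  by rewrite -ball_normE /= => ?; exists v.
have key (w : W) : `|w| = e / 2 -> exists2 v, `|v| <= n%:R *+ 2 & `|w - f v| <= e / 4.
  move=> we; have e8 : 0 < e / 8 by lra.
  have [|v1 v1n wv1] := approx (w0 + w) _ _ e8.
    by rewrite addrAC subrr add0r we; lra.
  have [|v2 v2n wv2] := approx w0 _ _ e8; first by rewrite subrr normr0.
  exists (v1 - v2).
    by rewrite (le_trans (ler_normB _ _))// mulr2n lerD// ltW.
  rewrite (linB lf) (_ : w - _ = (w0 + w - f v1) - (w0 - f v2)); last first.
    by rewrite !opprD !opprK addrACA [w0 + w]addrC -[w + w0 - w0]addrA subrr addr0.
  by rewrite (le_trans (ler_normB _ _))//; lra.
(* [key] applies to vectors of norm [e / 2]; the summand 1 keeps the constant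
   positive when [n] is 0. *)
exists ((n%:R *+ 2 + 1) * (2 / e)).
  by rewrite mulr_gt0 ?divr_gt0// ltr_wpDl// mulrn_wge0.
move=> w; have [->|w_neq0] := eqVneq w 0.
  by exists 0; rewrite (lin0 lf) subr0 !normr0 !mulr0.
have w0' : 0 < `|w| by rewrite normr_gt0.
have [|v vn wv] := key ((e / 2 / `|w|) *: w).
  by rewrite normrZ gtr0_norm ?divr_gt0// divfK// gt_eqF.
have c0 : 0 < 2 / e * `|w| by rewrite mulr_gt0// divr_gt0.
exists ((2 / e * `|w|) *: v); split.
  rewrite normrZ gtr0_norm// (le_trans (ler_wpM2l (ltW c0) vn))//.
  rewrite mulrAC ler_wpM2r// mulrC ler_wpM2r ?lerDl//.
  by rewrite ltW// divr_gt0.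
have -> : w - f ((2 / e * `|w|) *: v) =
    (2 / e * `|w|) *: (((e / 2 / `|w|) *: w) - f v).
  rewrite scalerBr (linZ lf) scalerA; congr (_ - _).
  rewrite [X in X *: _](_ : _ = 1) ?scale1r//.
  by field; rewrite !gt_eqF.
rewrite normrZ gtr0_norm// (le_trans (ler_wpM2l (ltW c0) wv))//.
by rewrite le_eqVlt; apply/orP; left; apply/eqP; field; rewrite gt_eqF.
Qed.

(** The open mapping theorem, quantitatively.  Applying the approximate preimage
    to the successive errors gives a geometric series, whose sum is a preimage by
    completeness. *)
Lemma bounded_preimage :
  exists2 K, 0 < K & forall w, exists2 v, f v = w & `|v| <= K * `|w|.
Proof.
have lf := blin_linear bf; have cf := blin_continuous bf.
have [K K0 /choice[g gP]] := approximate_preimage.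
exists (K * 2); first by rewrite mulr_gt0.
move=> w; pose r := fix r n := if n is m.+1 then r m - f (g (r m)) else w.
have rle n : `|r n| <= 2^-1 ^+ n * `|w|.
  elim: n => [|n ih] /=; first by rewrite expr0 mul1r.
  by rewrite (le_trans (gP _).2)// exprS -mulrA ler_pM2l.
have gle n : `|g (r n)| <= geometric (K * `|w|) 2^-1 n.
  by rewrite (le_trans (gP _).1)//= -mulrA ler_pM2l// mulrC.
have half1 : `|2^-1 : R| < 1 by rewrite ger0_norm//; lra.
have cn : cvgn [normed series (g \o r)].
  apply: (series_le_cvg _ _ gle (is_cvg_geometric_series half1)) => n //=.
  by rewrite !mulr_ge0// ltW.
have cs := normed_cvg cn.
exists (limn (series (g \o r))).
  have fs n : f (series (g \o r) n) = w - r n.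
    elim: n => [|n ih]; first by rewrite /series/= big_nil (lin0 lf) subrr.
    rewrite seriesSr (linD lf) ih /= opprB -addrA; congr (_ + _).
    by rewrite addrC.
  have fl : f (series (g \o r) n) @[n --> \oo] --> f (limn (series (g \o r))).
    exact: (cvg_comp _ _ cs (cf _)).
  have fw : f (series (g \o r) n) @[n --> \oo] --> w.
    rewrite (_ : (fun n => _) = (fun n => w - r n)); last exact/funext.
    rewrite -[X in _ --> X]subr0; apply: cvgB; first exact: cvg_cst.
    apply/norm_cvg0P; apply: (squeeze_cvgr (f := fun=> 0) (h := fun n => 2^-1 ^+ n * `|w|)).
    - by near=> n; rewrite normr_ge0 rle.
    - exact: cvg_cst.
    - rewrite -[X in _ --> X](mul0r `|w|); apply: cvgMl.
      exact: (cvg_expr half1).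
  exact: (cvg_unique (@norm_hausdorff _ _) fl fw).
apply: (le_trans (lim_series_norm cn)).
have := lim_series_le cn (is_cvg_geometric_series half1) gle.
move/le_trans; apply.
rewrite (cvg_lim _ (cvg_geometric_series half1))//.
by rewrite le_eqVlt; apply/orP; left; apply/eqP; field.
Unshelve. all: by end_near. Qed.

End OpenMapping.

(** * Neumann series and invariance of cones under resolvents *)

Definition inverse (R : realType) (V : normedModType R) (B S : V -> V) :=
  [/\ blin S, cancel B S & cancel S B].

Definition convex_cone (R : realType) (V : normedModType R) (Q : set V) :=
  [/\ closed Q, Q 0, forall x y, Q x -> Q y -> Q (x + y) &
      forall (a : R) x, 0 <= a -> Q x -> Q (a *: x)].

Definition preserves (T : Type) (Q : set T) (S : T -> T) :=
  forall x, Q x -> Q (S x).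

Definition scalar_sub (R : realType) (V : normedModType R) (T : V -> V) (t : R)
  (x : V) := t *: x - T x.

Lemma inverse_eq (R : realType) (V : normedModType R) (B S S' : V -> V) :
  inverse B S -> inverse B S' -> S =1 S'.
Proof. by move=> [_ BS SB] [_ BS' SB'] x; rewrite -{1}(SB' x) BS. Qed.

Lemma scalar_sub_linear (R : realType) (V : normedModType R) (T : V -> V) t :
  linear T -> linear (scalar_sub T t).
Proof.
move=> lT a x y; rewrite /scalar_sub lT scalerDr scalerBr !scalerA mulrC.
by rewrite opprD addrACA.
Qed.

Section Neumann.
Context (R : realType) (V : completeNormedModType R) (B S D : V -> V) (M d : R).
Hypotheses (lB : linear B) (BS : inverse B S) (SM : bounded_by M S).
Hypotheses (lD : linear D) (Dd : bounded_by d D) (M0 : 0 < M) (Md : M * d <= 2^-1).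

(** Writing [u = S (y + D u)] and absorbing the term with [D u], which is at
    most half of [`|u|]. *)
Lemma perturbed_apriori u y : B u - D u = y -> `|u| <= 2 * M * `|y|.
Proof.
case: BS => bS BK SK uy.
have -> : u = S (y + D u) by rewrite -uy subrK BK.
set v := y + D u; have vE : `|v| <= `|y| + d * `|S v|.
  have {1}-> : v = y + D (S v).
    by rewrite /v; congr (_ + D _); rewrite -uy subrK BK.
  by rewrite (le_trans (ler_normD _ _))// lerD2l.
have Sv := SM v.
have : M * `|v| <= M * `|y| + M * d * `|S v| by rewrite -mulrA -mulrDr ler_pM2l.
have : M * d * `|S v| <= 2^-1 * `|S v| by rewrite ler_wpM2r.
by lra.
Qed.

Let step y u := S (y + D u).

(** The solution is the fixed point of the contraction [u |-> S (y + D u)].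
    Solving inside a closed invariant set [Q] is what makes the inverse of
    [B - D] preserve the cones preserved by [S] and [D]. *)
Lemma perturbed_solution (Q : set V) y : closed Q -> Q !=set0 ->
  (forall u, Q u -> Q (step y u)) -> exists2 u, Q u & B u - D u = y.
Proof.
move=> cQ Q0 Qf; case: BS => bS BK SK.
have lS := blin_linear bS.
have fQ : set_fun Q Q (step y) by [].
have ctr : is_contraction (mkfun_fun fQ).
  have h0 : (0 : R) <= 2^-1 by rewrite invr_ge0.
  exists (NngNum h0); split => /=; first lra.
  move=> -[u v] _ /=; rewrite /mkfun /step -(linB lS) opprD addrACA subrr add0r.
  rewrite -(linB lD) (le_trans (SM _))//.
  rewrite (le_trans (ler_wpM2l (ltW M0) (Dd _)))//.
  by rewrite mulrA ler_wpM2r.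
have [u Qu uE] := banach_fixed_point ctr cQ Q0.
exists u => //; rewrite {1}uE /=/mkfun /step SK.
by rewrite addrK.
Qed.

Lemma neumann : exists2 S', inverse (fun x => B x - D x) S' &
  bounded_by (2 * M) S' /\ forall Q, convex_cone Q ->
    preserves Q S -> preserves Q D -> preserves Q S'.
Proof.
have sol y : exists u, B u - D u = y.
  by have [||u _ uy] := @perturbed_solution setT y closedT;
    [exists 0| |exists u].
have [S' S'E] := choice sol.
have lBD : linear (fun x => B x - D x).
  by move=> a x y; rewrite lB lD scalerBr opprD addrACA.
have inj u v : B u - D u = B v - D v -> u = v.
  move=> uv; apply/eqP; rewrite -subr_eq0 -normr_le0.
  have /perturbed_apriori : B (u - v) - D (u - v) = 0.
    by rewrite (linB lBD) uv subrr.
  by rewrite normr0 mulr0.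
have S'M : bounded_by (2 * M) S' by move=> y; exact: perturbed_apriori.
have S'K : cancel (fun x => B x - D x) S' by move=> x; apply: inj; rewrite S'E.
exists S'.
  split=> //; split; last by exists (2 * M).
  by move=> a x y; apply: inj; rewrite S'E lBD !S'E.
split=> // Q [cQ Q0 QD QZ] QS QQ x Qx.
have [||u Qu uE] := @perturbed_solution Q x cQ; first by exists 0.
  by move=> u Qu; apply: QS; apply: QD => //; exact: QQ.
by rewrite (_ : S' x = u)//; apply: inj; rewrite S'E.
Qed.

End Neumann.

Section ConePropagation.
Context (R : realType) (V : completeNormedModType R) (T : V -> V).
Hypothesis bT : blin T.

(** Moving [t] to the left adds a nonnegative multiple of the identity to the
    perturbation, so an invariant cone stays invariant in that direction. *)
Lemma scalar_sub_inverse_near (t s M : R) (S : V -> V) :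
  inverse (scalar_sub T t) S -> 0 < M -> bounded_by M S ->
  `|t - s| <= (2 * M)^-1 ->
  exists2 S', inverse (scalar_sub T s) S' &
    bounded_by (2 * M) S' /\
    (s <= t -> forall Q, convex_cone Q -> preserves Q S -> preserves Q S').
Proof.
move=> tS M0 SM ts; have lT := blin_linear bT.
have [|||S' S'E [S'M S'Q]] := neumann (D := fun x => (t - s) *: x)
   (d := (2 * M)^-1) (scalar_sub_linear t lT) tS SM _ _ M0.
- by move=> a x y; rewrite scalerDr !scalerA mulrC.
- by move=> x; rewrite normrZ ler_wpM2r.
- by rewrite invfM mulrCA mulfV ?gt_eqF// mulr1.
exists S'.
  have -> // : scalar_sub T s = (fun x => scalar_sub T t x - (t - s) *: x).
  apply/funext => x; by rewrite /scalar_sub scalerBl opprB [RHS]addrC addrA subrK.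
split=> // st Q QQ QS; apply: S'Q => // x Qx.
by case: QQ => _ _ _; apply => //; rewrite subr_ge0.
Qed.

Lemma scalar_sub_inverse_large (t M : R) : 0 < M -> bounded_by M T -> 2 * M <= t ->
  exists2 S, inverse (scalar_sub T t) S &
    forall Q, convex_cone Q -> preserves Q T -> preserves Q S.
Proof.
move=> M0 TM tM; have lT := blin_linear bT.
have t0 : 0 < t by lra.
have bt : inverse (fun x : V => t *: x) (fun x => t^-1 *: x).
  split=> [|x|x]; last 2 first.
  - by rewrite scalerA mulVf ?scale1r// gt_eqF.
  - by rewrite scalerA mulfV ?scale1r// gt_eqF.
  split; first by move=> a x y; rewrite scalerDr !scalerA mulrC.
  by exists t^-1 => x; rewrite normrZ gtr0_norm ?invr_gt0.
have [|||||S SE [_ SQ]] := neumann (D := T) (d := M) (M := t^-1) _ bt _ lT.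
- by move=> a x y; rewrite scalerDr !scalerA mulrC.
- by move=> x; rewrite normrZ gtr0_norm ?invr_gt0.
- by [].
- by rewrite invr_gt0.
- by rewrite ler_pdivrMl//; lra.
exists S => // Q QQ QT; apply: SQ => // x Qx.
by case: QQ => _ _ _; apply => //; rewrite invr_ge0 ltW.
Qed.

(** A continuous induction downwards on [t].  For large [t] the Neumann series
    is positive.  At the infimum of the good parameters, the inverse has
    some bound [M]; a good parameter close to it reaches, by a positive
    Neumann series of radius of order [1 / M], strictly below the infimum. *)
Lemma scalar_sub_inverse_preserves (Q : set V) (t0 : R) :
  convex_cone Q -> preserves Q T -> 
  (forall t, t0 <= t -> exists S, inverse (scalar_sub T t) S) ->
  forall t S, t0 <= t -> inverse (scalar_sub T t) S -> preserves Q S.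
Proof.
move=> QQ QT invT.
pose good t := forall S, inverse (scalar_sub T t) S -> preserves Q S.
have goodI t S : inverse (scalar_sub T t) S -> preserves Q S -> good t.
  by move=> tS QS S' tS' x Qx; rewrite (inverse_eq tS' tS); exact: QS.
pose E : set R := [set t | t0 <= t /\ forall s, t <= s -> good s].
suff [_ E0] : E t0 by move=> t S t0t; exact: E0.
have [N N0 TN] := blin_bound bT.
have EN : E (Num.max t0 (2 * N)).
  split=> [|s]; first by rewrite le_max lexx.
  rewrite ge_max => /andP[_ Ns].
  by have [S SE SQ] := scalar_sub_inverse_large N0 TN Ns; exact: (goodI _ _ SE (SQ _ QQ QT)).
have hE : has_inf E.
  split; first by exists (Num.max t0 (2 * N)).
  by exists t0 => t; case.
pose tau := inf E.
have t0tau : t0 <= tau by apply: lb_le_inf; [case: hE | move=> t []].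
have [S SE] := invT _ t0tau.
have [M M0 SM] : exists2 M, 0 < M & bounded_by M S by apply: blin_bound; case: SE.
have M8 : 0 < (8 * M)^-1 by rewrite invr_gt0 mulr_gt0.
have [t [t0t Et] ttau] := inf_adherent M8 hE.
have taut : tau <= t by apply: ge_inf => //; case: hE.
(* The step from [tau] up to [t] is less than [1 / (8 M)], and the inverse at
   [t] is bounded by [2 M], so it can be continued down by [1 / (4 M)], past
   [tau - 1 / (8 M)]. *)
have e2 : (2 * M)^-1 = 4 * (8 * M)^-1 by field; rewrite gt_eqF.
have e4 : (2 * (2 * M))^-1 = 2 * (8 * M)^-1 by field; rewrite gt_eqF.
have [|St StE [StM _]] := scalar_sub_inverse_near (s := t) SE M0 SM.
  by rewrite e2 distrC ger0_norm ?subr_ge0//; rewrite -/tau in ttau; lra.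
have QSt := Et _ (lexx t) _ StE.
have near s : tau - (8 * M)^-1 <= s -> s <= t -> good s.
  move=> ts st.
  have [||S' S'E [_ S'Q]] := scalar_sub_inverse_near (s := s) StE _ StM.
  - by rewrite mulr_gt0.
  - by rewrite e4 ger0_norm ?subr_ge0//; rewrite -/tau in ttau; lra.
  - by apply: (goodI _ S') => //; exact: S'Q.
have Es s : t0 <= s -> tau - (8 * M)^-1 <= s -> E s.
  move=> t0s taus; split=> // r sr.
  have [tr|rt] := leP t r; first exact: Et.
  by apply: near; [exact: le_trans sr | exact: ltW].
have [taut0|t0tau'] := leP (tau - (8 * M)^-1) t0; first exact: Es.
have : tau <= tau - (8 * M)^-1.
  by apply: ge_inf; [case: hE | apply: Es => //; exact: ltW].
by lra.
Qed.

End ConePropagation.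

(** * Linear spans: complements and compactness *)

Section LinearSpan.
Context (K : numFieldType) (E : lmodType K).
Implicit Types (s : seq E) (a u v : E).

Lemma lin_span_nil v : lin_span [::] v <-> v = 0.
Proof.
split=> [[c ->]|->]; first by rewrite big_ord0.
by exists (fun=> 0); rewrite big_ord0.
Qed.

Lemma lin_span_cons a s v :
  lin_span (a :: s) v <-> exists t, lin_span s (v - t *: a).
Proof.
split=> [[c ->]|[t [c vE]]].
  exists (c ord0), (fun i => c (lift ord0 i)).
  by rewrite big_ord_recl /= addrAC subrr add0r.
exists (fun i => if unlift ord0 i is Some j then c j else t).
rewrite big_ord_recl /= unlift_none -[LHS](subrK (t *: a)) vE addrC.
by congr (_ + _); apply: eq_bigr => i _; rewrite liftK.
Qed.

Lemma lin_span0 s : lin_span s 0.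
Proof. by exists (fun=> 0); rewrite big1// => i _; rewrite scale0r. Qed.

Lemma lin_spanP t s u v : lin_span s u -> lin_span s v -> lin_span s (t *: u + v).
Proof.
move=> [c ->] [d ->]; exists (fun i => t * c i + d i).
rewrite scaler_sumr -big_split /=; apply: eq_bigr => i _.
by rewrite scalerDl scalerA.
Qed.

Lemma lin_spanD s u v : lin_span s u -> lin_span s v -> lin_span s (u + v).
Proof. by move=> su sv; rewrite -[u]scale1r; exact: lin_spanP. Qed.

Lemma lin_spanZ t s u : lin_span s u -> lin_span s (t *: u).
Proof.
by move=> su; rewrite -[_ *: _]addr0; apply: lin_spanP => //; exact: lin_span0.
Qed.

(** A finite spanning set modulo [V] can be thinned out to span a direct
    complement of [V].  The induction enlarges [V] by the head of the list, and
    keeps the head only when it is outside [V]. *)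
Lemma complement_of_span (V : set E) s :
  V 0 -> (forall t u v, V u -> V v -> V (t *: u + v)) ->
  (forall x, exists2 v, V v & lin_span s (x - v)) ->
  exists2 s', forall x, exists2 v, V v & lin_span s' (x - v) &
    forall x, V x -> lin_span s' x -> x = 0.
Proof.
elim: s V => [|a s ih] V V0 VP Vs.
  by exists [::] => // x _ /lin_span_nil.
pose W : set E := [set u | exists t, V (u - t *: a)].
have [|||s' s'cod s'W] := ih W.
- by exists 0; rewrite scale0r subr0.
- move=> t u v [c Vu] [d Vv]; exists (t * c + d).
  rewrite [X in V X](_ : _ = t *: (u - c *: a) + (v - d *: a)); first exact: VP.
  by rewrite scalerBr scalerA scalerDl opprD addrACA.
- move=> x; have [v Vv /lin_span_cons[t sx]] := Vs x.
  exists (v + t *: a); first by exists t; rewrite addrK.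
  by rewrite opprD addrA.
have [Va|nVa] := pselect (V a).
  have WV u : W u -> V u.
    by move=> [t Vu]; rewrite -(subrK (t *: a) u) addrC; exact: VP.
  exists s' => [x|x Vx]; first by have [v /WV] := s'cod x; exists v.
  by apply: s'W; exists 0; rewrite scale0r subr0.
exists (a :: s') => [x|x Vx /lin_span_cons[t sx]].
  have [v [t Vv] sv] := s'cod x; exists (v - t *: a) => //.
  by apply/lin_span_cons; exists t; rewrite opprB [t *: a - v]addrC addrA addrK.
have xE : x = t *: a.
  apply/eqP; rewrite -subr_eq0; apply/eqP; apply: s'W => //.
  by exists (- t); rewrite scaleNr opprK subrK.
have [t0|t0] := eqVneq t 0; first by rewrite xE t0 scale0r.
case: nVa; rewrite (_ : a = t^-1 *: x + 0); first exact: VP.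
by rewrite addr0 xE scalerA mulVf ?scale1r.
Qed.

End LinearSpan.

(** Ultrafilters stand for subsequences in all compactness arguments below: they
    make limits exist simultaneously for all vectors. *)
Lemma ultra_compact_cvg (I : Type) (U : set_system I) (T : topologicalType)
    (A : set T) (w : I -> T) :
  UltraFilter U -> compact A -> U (w @^-1` A) ->
  exists2 l, A l & w i @[i --> U] --> l.
Proof.
move=> UU cA UA; have PU : ProperFilter U := @ultra_proper _ _ UU.
have [l [Al cl]] := cA (w @ U) _ UA.
exists l => // N Nl; have [//|UN] := in_ultra_setVsetC (w @^-1` N) UU.
by have [x []] := cl (~` N) N UN Nl.
Qed.

Lemma ultra_bounded_cvg (R : realType) (I : Type) (U : set_system I) (w : I -> R) M :
  UltraFilter U -> (\forall i \near U, `|w i| <= M) ->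
  exists l : R, w i @[i --> U] --> l.
Proof.
move=> UU wM; have PU : ProperFilter U := @ultra_proper _ _ UU.
have [||l _ wl] := @ultra_compact_cvg I U _ `[- M, M]%classic w UU.
- exact: segment_compact.
- by apply: filterS wM => i; rewrite /= in_itv /= ler_norml.
- by exists l.
Qed.

Section SpanCompactness.
Context (R : realType) (V : normedModType R).

(** Local compactness of finite-dimensional subspaces, by induction on the
    spanning list.  If [a] is outside the span of [s], then the induction
    hypothesis makes that span closed, hence at a distance [d > 0] from [a];
    this bounds the coefficient of [a] by [M / d], and the ultrafilter makes this
    coefficient and the remaining component converge. *)
Lemma span_ultra_cvg (s : seq V) (I : Type) (U : set_system I) (w : I -> V) M :
  UltraFilter U -> (\forall i \near U, lin_span s (w i)) ->
  (\forall i \near U, `|w i| <= M) ->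
  exists2 l, lin_span s l & w i @[i --> U] --> l.
Proof.
elim: s I U w M => [|a s ih] I U w M UU sw wM; have PU : ProperFilter U := @ultra_proper _ _ UU.
  exists 0; first exact: lin_span0.
  apply: cvg_near_cst; apply: filterS sw => i.
  by move=> /lin_span_nil.
have [sa|nsa] := pselect (lin_span s a).
  have [|l sl wl] := ih I U w M UU _ wM.
    apply: filterS sw => i /lin_span_cons[t st].
    by rewrite -(subrK (t *: a) (w i)); apply: lin_spanD => //; exact: lin_spanZ.
  exists l => //; apply/lin_span_cons; exists 0.
  by rewrite scale0r subr0.
have [d d0 da] : exists2 d, 0 < d & forall v, lin_span s v -> d <= `|a - v|.
  apply: contrapT => H; apply: nsa.
  (* If [a] is at distance 0 from the span, then an ultrafilter in the span
     converges to [a], and the induction hypothesis puts its limit in the span. *)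
  have ca : closure (lin_span s) a.
    move=> N /nbhs_ballP[e /= e0 eN]; apply: contrapT => NN; apply: H.
    exists e => // v sv; rewrite leNgt; apply/negP => ve; apply: NN.
    by exists v; split=> //; apply: eN; rewrite -ball_normE.
  have PF := within_nbhs_proper ca.
  have [F [UF sF]] := ultraFilterLemma PF.
  have PF' : ProperFilter F := @ultra_proper _ _ UF.
  have [||l sl Fl] := ih V F id (`|a| + 1) UF.
  - by apply: sF; rewrite /within /=; exact: filterE.
  - have na : \forall v \near nbhs a, `|v| <= `|a| + 1.
      by apply: (@cvgr_norm_le _ _ _ (nbhs a) _ id a) => //; rewrite ltrDl.
    by apply: sF; apply: filterS na.
  - rewrite (_ : a = l)//.
    apply: (@cvg_unique _ (@norm_hausdorff _ V) F) => //.
    by apply: cvg_trans (@cvg_within _ (nbhs a) _ (lin_span s)).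
have /choice[t tP] : forall i, exists t, lin_span (a :: s) (w i) -> lin_span s (w i - t *: a).
  move=> i; have [/lin_span_cons[t st]|nw] := pselect (lin_span (a :: s) (w i)).
    by exists t.
  by exists 0.
have tb : \forall i \near U, `|t i| <= M / d.
  near=> i; have st : lin_span s (w i - t i *: a) by apply: tP; near: i.
  have [->|ti0] := eqVneq (t i) 0.
    rewrite normr0 divr_ge0// ?(ltW d0)// (le_trans (normr_ge0 (w i)))//.
    by near: i.
  rewrite ler_pdivlMr// (@le_trans _ _ `|w i|)//; last by near: i.
  have : d <= `|a - - (t i)^-1 *: (w i - t i *: a)| by apply: da; exact: lin_spanZ.
  rewrite scaleNr opprK scalerBr scalerA mulVf// scale1r addrC subrK normrZ normfV.
  by rewrite ler_pdivlMl ?normr_gt0.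
have [c tc] := ultra_bounded_cvg UU tb.
have [||l sl wl] := ih I U (fun i => w i - t i *: a) (M + M / d * `|a|) UU.
- by near=> i; apply: tP; near: i.
- near=> i; rewrite (le_trans (ler_normB _ _))// lerD//; first by near: i.
  by rewrite normrZ ler_wpM2r//; near: i.
exists (l + c *: a); first by apply/lin_span_cons; exists c; rewrite addrK.
rewrite (_ : (fun _ => _) = fun i => (w i - t i *: a) + t i *: a); last first.
  by apply/funext => i; rewrite subrK.
by apply: cvgD => //; apply: cvgZr_tmp.
Unshelve. all: by end_near. Qed.

End SpanCompactness.

(** * Fredholm maps and the blow-up of the resolvent *)

Lemma near_eq_cvg_to (I : Type) (F : set_system I) (T : topologicalType)
    (f g : I -> T) (l : T) {FF : Filter F} :
  {near F, f =1 g} -> f i @[i --> F] --> l -> g i @[i --> F] --> l.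
Proof. by move=> fg; exact: cvg_trans (near_eq_cvg fg). Qed.

(** The open mapping theorem for [f] together with finitely many vectors, which
    are added one at a time by replacing the source [V] by [V * R]. *)
Lemma bounded_preimage_mod_span (R : realType) (V W : completeNormedModType R)
    (f : V -> W) (s : seq W) :
  blin f -> (forall w, exists v, lin_span s (w - f v)) ->
  exists2 K, 0 < K & forall w, exists v (c : 'I_(size s) -> R),
    [/\ w = f v + \sum_(i < size s) c i *: s`_i, `|v| <= K * `|w| &
        forall i, `|c i| <= K * `|w| ].
Proof.
elim: s V f => [|a s ih] V f bf sf.
  have [w|K K0 fK] := bounded_preimage bf.
    by have [v /lin_span_nil/eqP] := sf w; rewrite subr_eq0 eq_sym => /eqP; exists v.
  exists K => // w; have [v vw vK] := fK w.
  by exists v, (fun=> 0); split=> [||[]//]; rewrite ?big_ord0 ?addr0.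
have lf := blin_linear bf.
pose g (z : V * R^o) : W := f z.1 + z.2 *: a.
have bg : blin g.
  split=> [t u v|]; first by rewrite /g /= lf scalerDl scalerDr scalerA addrACA.
  have [M M0 fM] := blin_bound bf; exists (M + `|a|) => z.
  rewrite mulrDl (le_trans (ler_normD _ _))// lerD//.
    by rewrite (le_trans (fM _))// ler_pM2l// prod_normE le_max lexx.
  by rewrite normrZ mulrC ler_wpM2l// prod_normE le_max lexx orbT.
have [w|K K0 gK] := ih _ g bg.
  have [v /lin_span_cons[t st]] := sf w.
  by exists (v, t); rewrite /g /= opprD addrA.
exists K => // w; have [[v t] [c [wE vK cK]]] := gK w.
have [vK' tK'] : `|v| <= K * `|w| /\ `|t| <= K * `|w|.
  by move: vK; rewrite prod_normE /= ge_max => /andP[].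
exists v, (fun i => if unlift ord0 i is Some j then c j else t); split=> //.
  rewrite big_ord_recl /= unlift_none {1}wE /g /= -addrA; congr (_ + (_ + _)).
  by apply: eq_bigr => i _; rewrite liftK.
by move=> i; case: unliftP => [j _|_].
Qed.

(** The algebraic Fredholm property over the reals.  For a bounded map the
    closedness of the range follows from the open mapping theorem. *)
Definition fredholm_map (R : realType) (V : normedModType R) (B : V -> V) :=
  (exists s, forall x, B x = 0 -> lin_span s x) /\
  exists s, forall x, exists y, lin_span s (x - B y).

(** With a direct complement of the range, [B (w i)] has a preimage [v i] of
    comparable size, so that [v i] tends to 0, while [w i - v i] is a bounded
    family in the finite-dimensional kernel. *)
Lemma fredholm_ultra_cvg (R : realType) (V : completeNormedModType R) (B : V -> V)
    (I : Type) (U : set_system I) (w : I -> V) M :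
  blin B -> fredholm_map B -> UltraFilter U ->
  (\forall i \near U, `|w i| <= M) -> B (w i) @[i --> U] --> (0 : V) ->
  exists2 l, B l = 0 & w i @[i --> U] --> l.
Proof.
move=> bB [[k kerB] [s0 s0B]] UU wM Bw0; have PU : ProperFilter U := @ultra_proper _ _ UU.
have lB := blin_linear bB.
have [|||s sB sdirect] := @complement_of_span R V (range B) s0.
- by exists 0 => //; exact: (lin0 lB).
- by move=> t _ _ [u _ <-] [v _ <-]; exists (t *: u + v) => //; exact: lB.
- by move=> x; have [y sy] := s0B x; exists (B y) => //; exists y.
have [|K K0 BK] := bounded_preimage_mod_span (s := s) bB.
  by move=> x; have [_ [y _ <-]] := sB x; exists y.
have /choice[v vP] : forall i, exists v, B (w i - v) = 0 /\ `|v| <= K * `|B (w i)|.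
  move=> i; have [v [c [wE vK _]]] := BK (B (w i)); exists v; split=> //.
  apply: sdirect; first by exists (w i - v).
  by rewrite (linB lB) wE addrAC subrr add0r; exists c.
have v0 : v i @[i --> U] --> (0 : V).
  apply/norm_cvg0P.
  apply: (squeeze_cvgr (f := fun=> 0) (h := fun i => K * `|B (w i)|)).
  - by near=> i; rewrite normr_ge0 (vP i).2.
  - exact: cvg_cst.
  - rewrite -[X in _ --> X](mulr0 K); apply: cvgMr.
    by apply/norm_cvg0P.
have [||l _ ul] := @span_ultra_cvg R V k I U (fun i => w i - v i) (M + 1) UU.
- by apply: filterE => i; apply: kerB; exact: (vP i).1.
- near=> i; rewrite (le_trans (ler_normB _ _))// lerD//; near: i => //.
  by apply: cvgr_norm_le v0 _ _; rewrite normr0.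
have wl : w i @[i --> U] --> l.
  rewrite -[l]addr0 (_ : w = fun i => (w i - v i) + v i); last first.
    by apply/funext => i; rewrite subrK.
  exact: cvgD.
exists l => //.
have BwBl : B (w i) @[i --> U] --> B l.
  by apply: continuous_cvg => //; exact: (blin_continuous bB).
exact: (cvg_unique (@norm_hausdorff _ V) BwBl Bw0).
Unshelve. all: by end_near. Qed.

Section ResolventBlowup.
Context (R : realType) (V : completeNormedModType R) (T : V -> V) (r : R).
Context (S : R -> V -> V).
Hypotheses (bT : blin T) (SE : forall t, r < t -> inverse (scalar_sub T t) (S t)).
Hypothesis (fr : fredholm_map (scalar_sub T r)).
Hypothesis (nr : ~ exists S', inverse (scalar_sub T r) S').

Let B := scalar_sub T r.

Let bB : blin B.
Proof.
have lT := blin_linear bT; split; first exact: scalar_sub_linear.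
have [M M0 TM] := blin_bound bT; exists (`|r| + M) => x.
by rewrite mulrDl (le_trans (ler_normB _ _))// normrZ lerD2l.
Qed.

Let BE t x : B x = scalar_sub T t x - (t - r) *: x.
Proof. by rewrite /B /scalar_sub scalerBl opprB [RHS]addrC addrA subrK. Qed.

(** Decompose [x = B y + e] with [e] in the span of [s].  Then [S t x] is
    [y - (t - r) S t y] plus a combination of the [S t s`_i], with all
    coefficients controlled by [K `|x|].  So a bound [M] of [S t] can be improved
    to [K a + M / 2], and the best bound is at most [2 K a]. *)
Let uniform_bound : exists s, exists2 K, 0 < K &
  forall t, r < t -> (t - r) * K <= 2^-1 ->
    bounded_by (2 * K * (1 + \sum_(i < size s) `|S t s`_i|)) (S t).
Proof.
have lT := blin_linear bT; have lB := blin_linear bB.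
have [_ [s sB]] := fr; have [K K0 BK] := bounded_preimage_mod_span bB sB.
exists s, K => // t rt tK; have [bS SK KS] := SE rt; have lS := blin_linear bS.
set a := 1 + _.
have a0 : 0 <= a by rewrite addr_ge0// sumr_ge0.
have improve M : 0 <= M -> bounded_by M (S t) -> bounded_by (K * a + M / 2) (S t).
  move=> M0 SM x; have [y [c [xE yK cK]]] := BK x.
  have -> : S t x = y - (t - r) *: S t y + \sum_(i < size s) c i *: S t s`_i.
    rewrite [in LHS]xE (linD lS) (BE t) (linB lS) SK (linZ lS) (lin_sum lS).
    by congr (_ + _); apply: eq_bigr => i _; rewrite (linZ lS).
  have n1 : `|\sum_(i < size s) c i *: S t s`_i| <= K * (a - 1) * `|x|.
    rewrite (le_trans (ler_norm_sum _ _ _))// /a addrAC subrr add0r.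
    rewrite mulr_sumr mulr_suml ler_sum// => i _.
    by rewrite normrZ mulrAC ler_wpM2r.
  have n2 : `|(t - r) *: S t y| <= M / 2 * `|x|.
    rewrite normrZ ger0_norm ?subr_ge0 ?(ltW rt)//.
    have rt0 : 0 <= t - r by rewrite subr_ge0 ltW.
    rewrite (le_trans (ler_wpM2l rt0 (SM _)))//.
    rewrite (@le_trans _ _ ((t - r) * (M * (K * `|x|))))//.
      by rewrite ler_wpM2l// ler_wpM2l.
    have -> : (t - r) * (M * (K * `|x|)) = M * `|x| * ((t - r) * K) by ring.
    have -> : M / 2 * `|x| = M * `|x| * 2^-1 by ring.
    by rewrite ler_wpM2l// mulr_ge0.
  rewrite (le_trans (ler_normD _ _))//.
  have := ler_normB y ((t - r) *: S t y).
  by lra.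
pose E : set R := [set M | 0 <= M /\ bounded_by M (S t)].
have E0 : E !=set0 by have [M M0 SM] := blin_bound bS; exists M; split=> //; exact: ltW.
have hE : has_inf E by split=> //; exists 0 => M; case.
have m0 : 0 <= inf E by apply: lb_le_inf => // M [].
have mS : bounded_by (inf E) (S t).
  move=> x; have [->|x0] := eqVneq x 0; first by rewrite (lin0 lS) !normr0 mulr0.
  rewrite -ler_pdivrMr ?normr_gt0//; apply: lb_le_inf => // M [_ SM].
  by rewrite ler_pdivrMr ?normr_gt0.
have : inf E <= K * a + inf E / 2.
  apply: ge_inf; first by case: hE.
  by split; [rewrite addr_ge0 ?mulr_ge0 ?divr_ge0 ?(ltW K0) | exact: improve].
move=> mle x; rewrite (le_trans (mS x))// ler_wpM2r//; lra.
Qed.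

(** The normalization [a t] tends to infinity: otherwise the [S t] would be
    bounded near [r], and [r - T] would be invertible by a Neumann series.  The
    limit [C] is nonzero because [(a t)^-1] and the [`|S t s`_i| / a t] add up to
    1, while the first of these terms vanishes in the limit. *)
Lemma resolvent_blowup : exists (U : set_system R) (a : R -> R) (C : V -> V),
  [/\ UltraFilter U, r^'+ `<=` U, forall t, 0 < a t & (a t)^-1 @[t --> U] --> (0 : R)] /\
  [/\ blin C, forall x, (a t)^-1 *: S t x @[t --> U] --> C x,
      forall x, T (C x) = r *: C x & exists x, C x != 0].
Proof.
have lT := blin_linear bT; have lB := blin_linear bB.
have [s [K K0 SK]] := uniform_bound.
pose a t := 1 + \sum_(i < size s) `|S t s`_i|.
have a0 t : 0 < a t by rewrite ltr_pwDl// sumr_ge0.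
have [U [UU rU]] := ultraFilterLemma (at_right_proper_filter r).
have PU : ProperFilter U := @ultra_proper _ _ UU.
have nearr d : 0 < d -> \forall t \near U, r < t /\ t - r <= d.
  move=> d0; apply: rU; near=> t; split; first by near: t; exact: nbhs_right_gt.
  by rewrite lerBlDl ltW//; near: t; apply: nbhs_right_lt; rewrite ltrDl.
have SaU : \forall t \near U, r < t /\ bounded_by (2 * K * a t) (S t).
  have K2 : 0 < (2 * K)^-1 by rewrite invr_gt0 mulr_gt0.
  apply: filterS (nearr _ K2) => t [rt tr]; split=> //; apply: SK => //.
  by rewrite -ler_pdivlMr// -invfM.
have ainv0 : (a t)^-1 @[t --> U] --> (0 : R).
  apply/cvgrPdist_lt => e e0.
  have d0 : 0 < (2 * (2 * K / e))^-1 by rewrite invr_gt0 mulr_gt0// divr_gt0// mulr_gt0.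
  apply: filterS2 SaU (nearr _ d0) => t [rt St] [_ tr].
  rewrite sub0r normrN ger0_norm ?invr_ge0 ?(ltW (a0 t))//.
  rewrite ltNge; apply/negP => ea; apply: nr.
  have [|||S' ? _] := @scalar_sub_inverse_near R V T bT t r (2 * K / e) _ (SE rt).
  - by rewrite divr_gt0// mulr_gt0.
  - move=> x; rewrite (le_trans (St x))// ler_wpM2r// ler_wpM2l ?mulr_ge0 ?(ltW K0)//.
    by rewrite -[a t]invrK lef_pV2 ?posrE ?invr_gt0.
  - by rewrite ger0_norm ?subr_ge0 ?(ltW rt).
  - by exists S'.
have w_bound x : \forall t \near U, `|(a t)^-1 *: S t x| <= 2 * K * `|x|.
  apply: filterS SaU => t [rt St]; rewrite normrZ gtr0_norm ?invr_gt0//.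
  rewrite ler_pdivrMl// (le_trans (St x))// le_eqVlt; apply/orP; left; apply/eqP.
  by ring.
have Bw0 x : B ((a t)^-1 *: S t x) @[t --> U] --> (0 : V).
  have tr0 : t - r @[t --> U] --> (0 : R).
    apply/cvgrPdist_le => e e0; apply: filterS (nearr e e0) => t [rt tr].
    by rewrite sub0r normrN ger0_norm// subr_ge0 ltW.
  have Bwt : {near U, (fun t => (a t)^-1 *: x - (t - r) *: ((a t)^-1 *: S t x))
      =1 fun t => B ((a t)^-1 *: S t x)}.
    apply: filterS SaU => t [/SE[_ _ St] _].
    by rewrite [RHS](BE t) (linZ (scalar_sub_linear t lT)) St.
  apply: (near_eq_cvg_to Bwt).
  rewrite -[X in _ --> X](subr0 (0 : V)); apply: cvgB.
    by rewrite -[X in _ --> X](scale0r x); exact: cvgZr_tmp.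
  apply/norm_cvg0P.
  apply: (squeeze_cvgr (f := fun=> 0) (h := fun t => `|t - r| * (2 * K * `|x|))).
  - near=> t; rewrite normr_ge0/= normrZ ler_wpM2l//.
    by near: t; exact: w_bound.
  - exact: cvg_cst.
  - rewrite -[X in _ --> X](mul0r (2 * K * `|x|)); apply: cvgMl.
    by apply/norm_cvg0P.
have /choice[C CE] : forall x, exists l, B l = 0 /\ (a t)^-1 *: S t x @[t --> U] --> l.
  move=> x; have [l Bl wl] := fredholm_ultra_cvg bB fr UU (w_bound x) (Bw0 x).
  by exists l.
have uniq (F : R -> V) (l l' : V) : F t @[t --> U] --> l -> F t @[t --> U] --> l' -> l = l'.
  exact: (@cvg_unique _ (@norm_hausdorff _ V)).
exists U, a, C; split; split=> //.
- split.
    move=> b x y; apply: (uniq _ _ _ (CE _).2).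
    have Slin : {near U, (fun t => b *: ((a t)^-1 *: S t x) + (a t)^-1 *: S t y)
        =1 fun t => (a t)^-1 *: S t (b *: x + y)}.
      apply: filterS SaU => t [/SE[[lS _] _ _] _].
      by rewrite lS scalerDr !scalerA mulrC.
    apply: (near_eq_cvg_to Slin); apply: cvgD (CE y).2.
    by apply: cvgZl_tmp; exact: (CE x).2.
  exists (2 * K) => x.
  have /cvg_norm nC := (CE x).2.
  exact: cvgr_to_le nC (w_bound x).
- by move=> x; exact: (CE x).2.
- by move=> x; apply/esym/eqP; rewrite -subr_eq0; apply/eqP; exact: (CE x).1.
- apply: contrapT => nC.
  have C0 x : C x = 0.
    by apply: contrapT => /eqP Cx; apply: nC; exists x.
  have : (a t)^-1 + \sum_(i < size s) `|(a t)^-1 *: S t s`_i| @[t --> U] -->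
      0 + \sum_(i < size s) `|C s`_i|.
    apply: cvgD => //; apply: (cvg_big add_continuous) => i _; apply: cvg_norm; exact: (CE _).2.
  rewrite big1 => [|i _]; last by rewrite C0 normr0.
  rewrite addr0 (_ : (fun t => _) = fun=> 1).
    move=> /(cvg_unique (@norm_hausdorff _ R^o) (cvg_cst _)).
    by move/eqP; rewrite oner_eq0.
  apply/funext => t; rewrite -[X in X + _]mulr1.
  under eq_bigr do rewrite normrZ gtr0_norm ?invr_gt0//.
  by rewrite -mulr_sumr -mulrDr mulVf// gt_eqF.
Unshelve. all: by end_near. Qed.

End ResolventBlowup.

(** * Positive operators on an ordered Banach space *)

Lemma inverse_commutes (R : realType) (V : normedModType R) (B S J : V -> V) :
  inverse B S -> (forall x, B (J x) = J (B x)) -> forall x, S (J x) = J (S x).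
Proof. by move=> [_ BK SK] BJ x; rewrite -[in LHS](SK x) -BJ BK. Qed.

(** Multiplication of [z.1 + i z.2] by [c + i d]. *)
Definition rot (R : realType) (X : lmodType R) (c d : R) (z : X * X) : X * X :=
  (c *: z.1 - d *: z.2, c *: z.2 + d *: z.1).

Definition rot_comp (R : realType) (X : lmodType R) (T : X -> X) (c d : R)
  (z : X * X) : X * X := rot c d (T z.1, T z.2).

Section OrderedSpace.
Context (R : realType) (X : completeNormedModType R) (P : set X).

Lemma is_cone_convex : is_cone P -> convex_cone P.
Proof.
move=> [cP PD PZ PN]; split=> //.
by have : [set (0 : X)] 0 by []; rewrite -PN => -[].
Qed.

Lemma is_cone_pointed x : is_cone P -> P x -> P (- x) -> x = 0.
Proof.
move=> [_ _ _ PN] Px PNx.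
by have : (P `&` [set x | P (- x)]) x by []; rewrite PN.
Qed.

Lemma total_cone_eq0 (W : normedModType R) (f : X -> W) :
  total_cone P -> blin f -> (forall x, P x -> f x = 0) -> forall x, f x = 0.
Proof.
move=> tP bf fP x; apply: contrapT => /eqP fx.
have oU : open [set y | 0 < `|f y|].
  apply: (open_comp (f := fun y => `|f y|) (D := [set t | 0 < t])).
    by move=> y _; apply: cvg_norm; exact: (blin_continuous bf).
  exact: open_gt.
have [|w [/= fw [y Py [z Pz wE]]]] := tP _ _ oU; first by exists x; rewrite /= normr_gt0.
by move: fw; rewrite -wE (linB (blin_linear bf)) !fP// subrr normr0 ltxx.
Qed.

Variables (T : X -> X) (r : R).
Hypotheses (hP : is_cone P) (tP : total_cone P) (bT : blin T) (TP : preserves P T).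

Lemma inverse_family (V : normedModType R) (B : V -> V) :
  (forall t, r < t -> exists S, inverse (scalar_sub B t) S) ->
  exists S, forall t, r < t -> inverse (scalar_sub B t) (S t).
Proof.
move=> H; have /choice[S SE] : forall t, exists S,
    r < t -> inverse (scalar_sub B t) S.
  by move=> t; have [/H[S St]|_] := ltP r t; [exists S | exists id].
by exists S.
Qed.

(** The limit provided by [resolvent_blowup] inherits from the inverses of
    [t - T] that they preserve [P] and commute with [T]; totality of [P] gives a
    vector of [P] on which the limit does not vanish. *)
Lemma positive_leading_coefficient :
  (forall t, r < t -> exists S, inverse (scalar_sub T t) S) ->
  fredholm_map (scalar_sub T r) ->
  ~ (exists S, inverse (scalar_sub T r) S) ->
  exists C : X -> X, [/\ blin C, preserves P C, forall x, T (C x) = r *: C x,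
    forall x, C (T x) = r *: C x & exists2 x, P x & C x != 0].
Proof.
move=> iT fT nT; have lT := blin_linear bT.
have [S SE] := inverse_family iT.
have [U [a [C [[UU rU a0 ainv0] [bC CE TC [x0 Cx0]]]]]] := resolvent_blowup bT SE fT nT.
have PU : ProperFilter U := @ultra_proper _ _ UU.
have Ur : \forall t \near U, r < t by apply: rU; exact: nbhs_right_gt.
have [cP _ PD PZ] := is_cone_convex hP.
exists C; split=> //.
- move=> x Px; apply: (closed_cvg P cP _ _ (CE x)).
  apply: filterS Ur => t rt; apply: PZ; first by rewrite invr_ge0 ltW.
  apply: (@scalar_sub_inverse_preserves R X T bT P t _ _ _ t) => //.
  + exact: is_cone_convex.
  + by move=> s ts; apply: iT; exact: lt_le_trans ts.
  + exact: SE.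
- move=> x; rewrite -TC.
  have TCx : T ((a t)^-1 *: S t x) @[t --> U] --> T (C x).
    by apply: continuous_cvg => //; exact: (blin_continuous bT).
  apply: (cvg_unique (@norm_hausdorff _ X) (CE (T x))).
  apply: (near_eq_cvg_to _ TCx); apply: filterS Ur => t rt.
  rewrite (linZ lT); congr (_ *: _); apply/esym/(inverse_commutes (SE _ rt)) => y.
  by rewrite /scalar_sub (linB lT) (linZ lT).
- apply: contrapT => nC; have : C x0 = 0.
    apply: (total_cone_eq0 tP bC) => x Px; apply: contrapT => /eqP Cx.
    by apply: nC; exists x.
  by move/eqP; rewrite (negPf Cx0).
Qed.

Section Rotation.
Context (c d : R).
Hypothesis cd1 : c ^+ 2 + d ^+ 2 = 1.
Let Y := (X * X)%type.
Let rotT : Y -> Y := rot_comp T c d.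

Lemma rot_comp_blin : blin rotT.
Proof.
have lT := blin_linear bT; split.
  move=> a [x1 x2] [y1 y2]; rewrite /rotT /rot_comp /rot /= !lT; congr (_, _) => /=.
    rewrite !scalerDr !scalerN !scalerA opprD [c * a]mulrC [d * a]mulrC.
    by rewrite addrACA.
  by rewrite !scalerDr !scalerA [c * a]mulrC [d * a]mulrC addrACA.
have [M M0 TM] := blin_bound bT; exists ((`|c| + `|d|) * M) => -[x y].
have b1 : `|T x| <= M * `|((x, y) : Y)|.
  by rewrite (le_trans (TM _))// ler_pM2l// prod_normE le_max lexx.
have b2 : `|T y| <= M * `|((x, y) : Y)|.
  by rewrite (le_trans (TM _))// ler_pM2l// prod_normE le_max lexx orbT.
rewrite [leLHS]prod_normE ge_max -mulrA mulrDl; apply/andP; split => /=.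
  by rewrite (le_trans (ler_normB _ _))// !normrZ lerD// ler_wpM2l.
by rewrite (le_trans (ler_normD _ _))// !normrZ lerD// ler_wpM2l.
Qed.

(** The pairs [(x, z)] with [x + Re (u z)] in [P] for all [u = p + i q] of
    modulus 1: a substitute for the relation [|z| <= x] of a Banach lattice. *)
Let tcone : set (X * Y) :=
  [set z | forall p q : R, p ^+ 2 + q ^+ 2 = 1 -> P (z.1 + (p *: z.2.1 - q *: z.2.2))].

Let tcone_convex : convex_cone tcone.
Proof.
have [cP P0 PD PZ] := is_cone_convex hP.
split.
- have -> : tcone = \bigcap_(pq in [set pq : R * R | pq.1 ^+ 2 + pq.2 ^+ 2 = 1])
      ((fun z : X * Y => z.1 + (pq.1 *: z.2.1 - pq.2 *: z.2.2)) @^-1` P).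
    apply/seteqP; split=> [z zP [p q] /= pq|z zP p q pq]; first exact: zP.
    exact: (zP (p, q)).
  apply: closed_bigI => -[p q] _; apply: closed_comp => // z _ /=.
  have c2 : {for z, continuous (fun z : X * Y => z.2)} by exact: cvg_snd.
  have c21 : {for z, continuous (fun z : X * Y => z.2.1)}.
    by apply: continuous_comp => //; exact: cvg_fst.
  have c22 : {for z, continuous (fun z : X * Y => z.2.2)}.
    by apply: continuous_comp => //; exact: cvg_snd.
  apply: cvgD; first exact: cvg_fst.
  by apply: cvgB; apply: cvgZl_tmp.
- by move=> p q _ /=; rewrite !scaler0 subrr addr0.
- move=> x y xP yP p q pq; have := PD _ _ (xP p q pq) (yP p q pq).
  congr (P _); rewrite /= addrACA; congr (_ + _).
  by rewrite addrACA !scalerDr opprD.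
- move=> a x a0 xP p q pq /=.
  rewrite !scalerA [p * a]mulrC [q * a]mulrC -!scalerA -scalerBr -scalerDr.
  by apply: PZ => //; exact: xP.
Qed.

Let TT (z : X * Y) : X * Y := (T z.1, rotT z.2).

Let TT_blin : blin TT.
Proof.
have lT := blin_linear bT; have [lr _] := rot_comp_blin.
have [M M0 TM] := blin_bound bT; have [N N0 rN] := blin_bound rot_comp_blin.
split; first by move=> a x y; rewrite /TT /= lT lr.
exists (M + N) => z; rewrite [leLHS]prod_normE ge_max mulrDl.
have n1 : `|z.1| <= `|z| by rewrite [leRHS]prod_normE le_max lexx.
have n2 : `|z.2| <= `|z| by rewrite [leRHS]prod_normE le_max lexx orbT.
apply/andP; split => /=.
  rewrite (le_trans (TM _))// (le_trans (ler_wpM2l (ltW M0) n1))// lerDl.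
  by rewrite mulr_ge0// ltW.
rewrite (le_trans (rN _))// (le_trans (ler_wpM2l (ltW N0) n2))// lerDr.
by rewrite mulr_ge0// ltW.
Qed.

Let TT_tcone : preserves tcone TT.
Proof.
have lT := blin_linear bT.
move=> [x [y1 y2]] zP p q pq /=.
have e : (p * c - q * d) ^+ 2 + (p * d + q * c) ^+ 2 = 1.
  have <- : (p ^+ 2 + q ^+ 2) * (c ^+ 2 + d ^+ 2) = 1 by rewrite pq cd1 mulr1.
  by ring.
have := TP (zP _ _ e); congr (P _).
rewrite /= (linD lT) (linB lT) !(linZ lT); congr (_ + _).
rewrite !scalerBr !scalerDr !scalerBl !scalerDl !scalerA !opprD.
by rewrite addrACA; congr (_ + _); rewrite addrC.
Qed.

Let TT_inverse t (S : X -> X) (S' : Y -> Y) : inverse (scalar_sub T t) S ->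
  inverse (scalar_sub rotT t) S' ->
  inverse (scalar_sub TT t) (fun z => (S z.1, S' z.2)).
Proof.
move=> [[lS [M SM]] SK KS] [[lS' [M' SM']] SK' KS'].
split=> [|[x y]|[x y]]; last 2 first.
- by congr (_, _); [exact: SK | exact: SK'].
- by congr (_, _); [exact: KS | exact: KS'].
split; first by move=> a x y; rewrite /= lS lS'.
exists (`|M| + `|M'|) => z; rewrite [leLHS]prod_normE ge_max mulrDl.
have n1 : `|z.1| <= `|z| by rewrite [leRHS]prod_normE le_max lexx.
have n2 : `|z.2| <= `|z| by rewrite [leRHS]prod_normE le_max lexx orbT.
have b1 : `|S z.1| <= `|M| * `|z|.
  by rewrite (le_trans (SM _))// (le_trans (ler_wpM2r _ (ler_norm _)))// ler_wpM2l.
have b2 : `|S' z.2| <= `|M'| * `|z|.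
  by rewrite (le_trans (SM' _))// (le_trans (ler_wpM2r _ (ler_norm _)))// ler_wpM2l.
apply/andP; split => /=.
  by rewrite (le_trans b1)// lerDl mulr_ge0.
by rewrite (le_trans b2)// lerDr mulr_ge0.
Qed.

(** If [r - w T] were not invertible, then the limit [C] of the normalized
    inverses of [t - w T] would satisfy [(0, C x)] in [tcone] for [x] in [P].
    Taking [u] among [1, -1, i, -i] puts both components of [C x] in [P] and
    [- P].  Thus [C] vanishes on [P], then on [X] by totality, then on [X * X]
    because it commutes with the multiplication by [i]. *)
Lemma rotated_inverse :
  (forall t, r <= t -> exists S, inverse (scalar_sub T t) S) ->
  (forall t, r < t -> exists S, inverse (scalar_sub rotT t) S) ->
  fredholm_map (scalar_sub rotT r) ->
  exists S, inverse (scalar_sub rotT r) S.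
Proof.
move=> iT irT fT; apply: contrapT => nT; have lT := blin_linear bT.
have [S SE] := inverse_family (fun t rt => iT t (ltW rt)).
have [S' SE'] := inverse_family irT.
have [U [a [C [[UU rU a0 ainv0] [bC CE _ [z Cz]]]]]] :=
  resolvent_blowup rot_comp_blin SE' fT nT.
have PU : ProperFilter U := @ultra_proper _ _ UU.
have Ur : \forall t \near U, r < t by apply: rU; exact: nbhs_right_gt.
have lC := blin_linear bC; have [cQ _ _ QZ] := tcone_convex.
have S0 x : (a t)^-1 *: S t x @[t --> U] --> (0 : X).
  have [Sr SrE] := iT r (lexx r).
  have [M M0 SM] : exists2 M, 0 < M & bounded_by M Sr by apply: blin_bound; case: SrE.
  have M2 : 0 < (2 * M)^-1 by rewrite invr_gt0 mulr_gt0.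
  apply/norm_cvg0P.
  apply: (squeeze_cvgr (f := fun=> 0) (h := fun t => (a t)^-1 * (2 * M * `|x|))).
  - near=> t; rewrite normr_ge0 /= normrZ gtr0_norm ?invr_gt0// ler_wpM2l ?invr_ge0 ?(ltW (a0 _))//.
    have rt : r < t by near: t.
    have [|St StE [StM _]] := scalar_sub_inverse_near bT (s := t) SrE M0 SM.
      rewrite distrC ger0_norm ?subr_ge0 ?(ltW rt)// lerBlDl ltW//.
      by near: t; apply: rU; apply: nbhs_right_lt; rewrite ltrDl.
    by rewrite (inverse_eq (SE _ rt) StE).
  - exact: cvg_cst.
  - by rewrite -[X in _ --> X](mul0r (2 * M * `|x|)); exact: cvgMl.
have CP x : P x -> C (x, 0) = 0.
  move=> Px; have : tcone (0, C (x, 0)).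
    have SC : ((a t)^-1 *: S t x, (a t)^-1 *: S' t (x, 0)) @[t --> U] -->
        ((0, C (x, 0)) : X * Y) by exact: cvg_pair (S0 x) (CE (x, 0)).
    apply: (closed_cvg tcone cQ _ _ SC).
    apply: filterS Ur => t rt.
    have -> : ((a t)^-1 *: S t x, (a t)^-1 *: S' t (x, 0)) =
      (a t)^-1 *: ((S t x, S' t (x, 0)) : X * Y) by [].
    apply: QZ; first by rewrite invr_ge0 ltW.
    apply: (@scalar_sub_inverse_preserves R _ TT TT_blin tcone t tcone_convex TT_tcone
      _ t (fun z => (S t z.1, S' t z.2)) (lexx t) _ (x, (x, 0))).
    - move=> s ts; have rs := lt_le_trans rt ts.
      by exists (fun z => (S s z.1, S' s z.2)); exact: TT_inverse (SE _ rs) (SE' _ rs).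
    - exact: TT_inverse (SE _ rt) (SE' _ rt).
    - move=> p q pq /=; rewrite scaler0 subr0 -[X in X + _]scale1r -scalerDl.
      by have [_ _ _ PZ] := is_cone_convex hP; apply: PZ => //; nra.
  case: (C (x, 0)) => u v uvP.
  have Pu : u = 0.
    apply: (is_cone_pointed hP).
      by have := uvP 1 0; rewrite /= scale0r subr0 scale1r add0r; apply; ring.
    by have := uvP (- 1) 0; rewrite /= scale0r subr0 scaleN1r add0r; apply; ring.
  have Pv : v = 0.
    apply: (is_cone_pointed hP).
      by have := uvP 0 (- 1); rewrite /= scale0r add0r scaleN1r opprK add0r; apply; ring.
    by have := uvP 0 1; rewrite /= scale0r add0r scale1r add0r; apply; ring.
  by rewrite Pu Pv.
have C1 x : C (x, 0) = 0.
  apply: (total_cone_eq0 tP (f := fun x => C (x, 0))) => //.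
  split.
    move=> b u v; rewrite -lC; congr C; congr (_, _) => /=.
    by rewrite scaler0 addr0.
  have [M M0 CM] := blin_bound bC; exists M => u.
  by rewrite (le_trans (CM _))// ler_pM2l// prod_normE ge_max /= lexx normr0 normr_ge0.
(* multiplication by [i] *)
pose J (z : Y) : Y := (- z.2, z.1).
have BJ t y : scalar_sub rotT t (J y) = J (scalar_sub rotT t y).
  rewrite /J /scalar_sub /rotT /rot_comp /rot /=; congr (_, _) => /=.
    by rewrite (linN lT) !scalerN -opprD; congr (- (_ + _)); rewrite opprD.
  by rewrite (linN lT) scalerN opprB.
have CJ y : C (J y) = J (C y).
  have cJ : {for (C y), continuous J}.
    by apply: cvg_pair; [apply: cvgN; exact: cvg_snd | exact: cvg_fst].
  have JC : J ((a t)^-1 *: S' t y) @[t --> U] --> J (C y).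
    by apply: continuous_cvg; [exact: cJ | exact: CE].
  apply: (cvg_unique (@norm_hausdorff _ _) (CE (J y))).
  apply: (near_eq_cvg_to _ JC); apply: filterS Ur => t rt.
  rewrite (inverse_commutes (SE' _ rt) (BJ t)) /J /=; congr (_, _) => /=.
  by rewrite scalerN.
move/eqP : Cz; apply; have -> : z = (z.1, 0) + J (z.2, 0).
  by case: z => z1 z2; congr (_, _) => /=; rewrite ?oppr0 ?addr0 ?add0r.
by rewrite (linD lC) CJ !C1 add0r /J /= oppr0.
Unshelve. all: by end_near. Qed.

End Rotation.

End OrderedSpace.

(** * The Hahn-Banach theorem and separation from a cone *)

Section HahnBanach.
Context (R : realType) (V : lmodType R) (p : V -> R).
Hypothesis pD : forall x y, p (x + y) <= p x + p y.
Hypothesis pZ : forall a x, 0 < a -> p (a *: x) <= a * p x.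

Let p0 : p 0 = 0.
Proof.
apply/eqP; rewrite eq_le; apply/andP; split.
  have h : (0 : R) < 2^-1 by rewrite invr_gt0.
  by have := pZ 0 h; rewrite scaler0; lra.
by have := pD 0 0; rewrite addr0; lra.
Qed.

Let pZge a x : 0 < a -> a * p x <= p (a *: x).
Proof.
move=> a0; rewrite -ler_pdivlMl//.
have ai : 0 < a^-1 by rewrite invr_gt0.
by rewrite (le_trans _ (pZ (a *: x) ai))// scalerA mulVf ?scale1r// gt_eqF.
Qed.

Let pN x : - p x <= p (- x).
Proof. by have := pD x (- x); rewrite subrr p0; lra. Qed.

Let lin_closed (G : set (V * R)) :=
  forall a x s y t, G (x, s) -> G (y, t) -> G (a *: x + y, a * s + t).

Let dominated (G : set (V * R)) := forall x s, G (x, s) -> s <= p x.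

(** Graphs of partial linear functionals dominated by [p], each extending
    [a v0 |-> a p v0].  The last clause is conditional so that the empty set,
    which is the union of the empty chain, is admissible. *)
Let admissible v0 (G : set (V * R)) :=
  [/\ lin_closed G, dominated G & forall z, G z -> G (v0, p v0)].

Let admissible_union v0 (F : set (set (V * R))) :
  F `<=` admissible v0 -> total_on F subset ->
  admissible v0 (\bigcup_(X in F) X).
Proof.
move=> FP Ft; split.
- move=> a x s y t [X FX Xxs] [Y FY Yyt].
  have [XY|YX] := Ft _ _ FX FY.
    by exists Y => //; case: (FP _ FY) => lY _ _; apply: lY => //; exact: XY.
  by exists X => //; case: (FP _ FX) => lX _ _; apply: lX => //; exact: YX.
- by move=> x s [X FX Xxs]; case: (FP _ FX) => _ dX _; exact: dX.
- by move=> z [X FX Xz]; exists X => //; case: (FP _ FX) => _ _; apply; exact: Xz.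
Qed.

Let admissible_line v0 :
  admissible v0 [set z | exists a, z = (a *: v0, a * p v0)].
Proof.
split.
- move=> a x s y t [b [-> ->]] [c [-> ->]]; exists (a * b + c).
  by rewrite scalerDl scalerA mulrDl mulrA.
- move=> x s [a [-> ->]]; have [a0|a0|->] := ltgtP a 0.
  + have na0 : 0 < - a by rewrite oppr_gt0.
    have := pN (- a *: v0); rewrite -scaleNr opprK; apply: le_trans.
    by have := pZ v0 na0; lra.
  + exact: pZge.
  + by rewrite scale0r mul0r p0.
- by move=> z _; exists 1; rewrite scale1r mul1r.
Qed.

(** The value [al] at the new vector [x] has to lie between all
    [s - p (u - x)] and all [p (u + x) - s]; the supremum of the former works. *)
Let extend_by v0 (A : set (V * R)) x : admissible v0 A -> A (v0, p v0) ->
  (forall s, ~ A (x, s)) -> exists2 B, admissible v0 B & A `<` B.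
Proof.
move=> [lA dA _] Av0 nAx.
have A0 : A (0, 0).
  have := lA (-1) _ _ _ _ Av0 Av0.
  by rewrite scaleN1r addNr mulN1r addNr.
pose E : set R := [set z | exists u s, A (u, s) /\ z = s - p (u - x)].
have Eub u' s' : A (u', s') -> ubound E (p (u' + x) - s').
  move=> A' _ [u [s [Aus ->]]].
  have := dA _ _ (lA 1 _ _ _ _ Aus A'); rewrite scale1r mul1r => H.
  have := pD (u - x) (u' + x); rewrite addrACA addNr addr0; lra.
have hE : has_sup E.
  split; first by exists (0 - p (0 - x)), 0, 0.
  by exists (p (0 + x) - 0); exact: Eub.
pose al := sup E.
have al1 u s : A (u, s) -> s + al <= p (u + x).
  by move=> /Eub/(ge_sup hE.1); rewrite -/al; lra.
have al2 u s : A (u, s) -> s - al <= p (u - x).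
  move=> Aus; have : s - p (u - x) <= al by apply: (ub_le_sup hE.2); exists u, s.
  by lra.
pose B : set (V * R) :=
  [set z | exists u s t, A (u, s) /\ z = (u + t *: x, s + t * al)].
have AB : A `<=` B.
  by move=> [u s] Aus; exists u, s, 0; rewrite scale0r mul0r !addr0.
exists B; last first.
  split=> // BA; apply: (nAx al); apply: BA.
  by exists 0, 0, 1; rewrite scale1r mul1r !add0r.
have AZ a u s : A (u, s) -> A (a *: u, a * s).
  by move=> Aus; have := lA a _ _ _ _ Aus A0; rewrite !addr0.
split.
- move=> a y s z t [u [s1 [t1 [Au [-> ->]]]]] [v [s2 [t2 [Av [-> ->]]]]].
  exists (a *: u + v), (a * s1 + s2), (a * t1 + t2); split; first exact: lA.
  congr (_, _); last by ring.
  by rewrite scalerDr scalerDl scalerA addrACA.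
- move=> _ _ [u [s [t [Aus [-> ->]]]]]; have [t0|t0|->] := ltgtP t 0.
  + have nt0 : 0 < - t by rewrite oppr_gt0.
    have := al2 _ _ (AZ (- t)^-1 _ _ Aus).
    rewrite -(ler_pM2l nt0) => H.
    have := pZge ((- t)^-1 *: u - x) nt0; rewrite scalerBr scalerA.
    rewrite mulfV ?gt_eqF// scale1r scaleNr opprK; apply: le_trans.
    apply: le_trans H; rewrite mulrBr mulrA mulfV ?gt_eqF// mul1r; lra.
  + have := al1 _ _ (AZ t^-1 _ _ Aus).
    rewrite -(ler_pM2l t0) => H.
    have := pZge (t^-1 *: u + x) t0; rewrite scalerDr scalerA.
    rewrite mulfV ?gt_eqF// scale1r; apply: le_trans.
    by apply: le_trans H; rewrite mulrDr mulrA mulfV ?gt_eqF// mul1r.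
  + by rewrite scale0r mul0r !addr0; exact: dA.
- by move=> _ _; exact: AB.
Qed.

Lemma hahn_banach v0 : exists f : V -> R,
  [/\ forall a x y, f (a *: x + y) = a * f x + f y, forall x, f x <= p x & f v0 = p v0].
Proof.
have [A [admA maxA]] := @Zorn_bigcup _ (admissible v0) (@admissible_union v0).
have Av0 : A (v0, p v0).
  case: (pselect (A !=set0)) => [[z Az]|A0]; first by case: admA => _ _; apply; exact: Az.
  exfalso; apply: (maxA _ _ (admissible_line v0)); split.
    by move=> z Az; case: A0; exists z.
  by move=> H; apply: A0; exists (1 *: v0, 1 * p v0); apply: H; exists 1.
have /choice[f fA] : forall x, exists s, A (x, s).
  move=> x; apply: contrapT => nx.
  have [|B admB AB] := extend_by admA Av0 (x := x); last exact: (maxA _ AB).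
  by move=> s As; apply: nx; exists s.
have [lA dA _] := admA.
have uniq x s t : A (x, s) -> A (x, t) -> s <= t.
  move=> As At; have := dA _ _ (lA (-1) _ _ _ _ At As).
  by rewrite scaleN1r addNr p0; lra.
have fE x s : A (x, s) -> f x = s.
  by move=> As; apply/eqP; rewrite eq_le !(uniq x)//.
exists f; split=> [a x y|x|]; last exact: fE.
  by apply: fE; exact: lA.
exact: dA.
Qed.

End HahnBanach.

(** Hahn-Banach for the distance to [- P], which is sublinear because [P] is a
    convex cone, vanishes on [- P], and is positive at [y]. *)
Lemma cone_separation (R : realType) (X : normedModType R) (P : set X) (y : X) :
  convex_cone P -> ~ P (- y) -> exists f : X -> R,
    [/\ linear (f : X -> R^o), continuous f, forall x, P x -> 0 <= f x & 0 < f y].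
Proof.
move=> [cP P0 PD PZ] Py.
pose E x : set R := [set `|x + k| | k in P].
pose p x := inf (E x).
have E0 x : E x !=set0 by exists `|x + 0|, 0.
have Elb x : has_lbound (E x) by exists 0 => _ [k _ <-].
have ple x k : P k -> p x <= `|x + k| by move=> Pk; apply: ge_inf => //; exists k.
have lep x b : (forall k, P k -> b <= `|x + k|) -> b <= p x.
  by move=> bk; apply: lb_le_inf => // _ [k Pk <-]; exact: bk.
have pD u v : p (u + v) <= p u + p v.
  rewrite -lerBlDr; apply: (lep _ _) => k Pk.
  rewrite lerBlDr -lerBlDl; apply: (lep _ _) => l Pl.
  rewrite lerBlDl (le_trans (ple _ _ (PD _ _ Pk Pl)))//.
  by rewrite addrACA ler_normD.
have pZ a u : 0 < a -> p (a *: u) <= a * p u.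
  move=> a0; rewrite -ler_pdivrMl//; apply: (lep _ _) => k Pk.
  rewrite ler_pdivrMl// (le_trans (ple _ _ (PZ _ _ (ltW a0) Pk)))//.
  by rewrite -scalerDr normrZ gtr0_norm.
have py : 0 < p y.
  have : nbhs (- y) (~` P) by apply: open_nbhs_nbhs; split=> //; exact: closed_openC.
  move=> /nbhs_ballP[e /= e0 eP]; apply: (lt_le_trans e0); apply: (lep _ _) => k Pk.
  rewrite leNgt; apply/negP => ke; apply: (eP k) Pk.
  by rewrite -ball_normE /= -opprD normrN.
have [f [lf fp fy]] := hahn_banach pD pZ y.
have lf' : linear (f : X -> R^o) by exact: lf.
exists f; split=> //; last by rewrite fy.
- apply: (lin_bounded_continuous lf'); exists 1 => x; rewrite mul1r.
  have pn z : f z <= `|z| by rewrite (le_trans (fp z))// -[z in leRHS]addr0 ple.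
  rewrite ler_norml pn andbT lerNl -(linN lf') -normrN; exact: pn.
- move=> x Px; rewrite -oppr_le0 -(linN lf') (le_trans (fp _))//.
  by rewrite (le_trans (ple _ _ Px))// addNr normr0.
Qed.

(** * From the operator to its resolvent *)

Section Resolvent.
Context (K : numFieldType) (E : lmodType K) (A : operator E) (l : K).
Hypothesis bij : set_bij (op_dom A) setT (Defs.shift l A).

Lemma resolvent_domP f : op_dom A (resolvent l A f) /\ Defs.shift l A (resolvent l A f) = f.
Proof.
have [_ _ /(_ f Logic.I)[u du uf]] := bij.
by apply: (xgetPex 0 (P := [set u | op_dom A u /\ Defs.shift l A u = f])); exists u.
Qed.

Lemma shift_inj u v : op_dom A u -> op_dom A v -> Defs.shift l A u = Defs.shift l A v -> u = v.
Proof. by have [_ inj _] := bij => du dv; apply: inj; rewrite inE. Qed.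

Lemma resolventP f u : op_dom A u -> Defs.shift l A u = f -> resolvent l A f = u.
Proof. by move=> du uf; have [dr rf] := resolvent_domP f; apply: shift_inj => //; rewrite rf. Qed.

End Resolvent.

Lemma shift_complexifyE (R : realType) (X : lmodType R) (A : operator X) (a b : R)
    (z : complexification X) : Defs.shift (a +i* b) (complexify A) z =
  (a *: z.1 - b *: z.2 - A z.1, a *: z.2 + b *: z.1 - A z.2).
Proof. by []. Qed.

(** Over the reals, a list is completed by the multiples by [i] of its entries. *)
Lemma complex_real_span (R : realType) (X : normedModType R)
    (s : seq (complexification X)) : exists s' : seq (X * X),
  forall z, lin_span s z -> lin_span s' (z : X * X).
Proof.
elim: s => [|a s [s' ss']].
  by exists [::] => z /lin_span_nil ->; apply/lin_span_nil.
exists ((a : X * X) :: rot 0 1 (a : X * X) :: s') => z /lin_span_cons[[p q] /ss' sz].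
apply/lin_span_cons; exists p; apply/lin_span_cons; exists q.
congr (lin_span s' _) : sz; rewrite /rot; case: z => z1 z2; case: a => a1 a2.
congr (_, _) => /=.
  by rewrite scale0r sub0r scale1r scalerN opprK opprB addrA addrAC.
by rewrite scale0r add0r scale1r opprD addrA.
Qed.

Lemma lin_span_map (R : realType) (V W : normedModType R) (f : V -> W) (s : seq V) z :
  linear f -> lin_span s z -> lin_span (map f s) (f z).
Proof.
move=> lf; elim: s z => [z /lin_span_nil ->|a s ih z /lin_span_cons[t /ih]].
  by rewrite (lin0 lf); apply/lin_span_nil.
by rewrite (linB lf) (linZ lf) => fs; apply/lin_span_cons; exists t.
Qed.

Section Bridge.
Context (R : realType) (X : completeNormedModType R) (A : operator X) (m : R).
Hypothesis rm : rho A m%:C.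
Local Notation Ac := (complexify A).
Local Notation T := (resolvent m A).
Local Notation Y := (X * X)%type.

Lemma real_resolvent_bij : set_bij (op_dom A) setT (Defs.shift m A).
Proof.
have [[_ inj surj] _] := rm.
have sE u v : Defs.shift m%:C Ac (u, v) = (Defs.shift m A u, Defs.shift m A v).
  by rewrite shift_complexifyE /= !scale0r subr0 addr0.
split=> // [u v|x _].
  rewrite !inE => du dv uv.
  have : ((u, 0) : complexification X) = (v, 0).
    apply: inj; rewrite ?inE; try by split => //; exact: op_dom0.
    by apply: etrans (sE u 0) (etrans _ (esym (sE v 0))); rewrite uv.
  by case.
have [[u v] [/= du dv] uvx] := surj (x, 0) Logic.I.
by have [<- _] := etrans (esym (sE u v)) uvx; exists u.
Qed.

Lemma resolvent_dom x : op_dom A (T x).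
Proof. exact: (resolvent_domP real_resolvent_bij x).1. Qed.

Lemma resolventK x : m *: T x - A (T x) = x.
Proof. exact: (resolvent_domP real_resolvent_bij x).2. Qed.

Lemma op_resolvent x : A (T x) = m *: T x - x.
Proof. by rewrite -[X in _ - X](resolventK x) opprB [RHS]addrC subrK. Qed.

Lemma shiftK u : op_dom A u -> T (m *: u - A u) = u.
Proof. by move=> du; apply: (resolventP real_resolvent_bij). Qed.

Lemma resolvent_blin : blin T.
Proof.
apply: continuous_blin.
  move=> a x y; apply: (resolventP real_resolvent_bij).
    by apply: op_domP; exact: resolvent_dom.
  have := @shift_linear R X m A a (T x) (T y) (resolvent_dom x) (resolvent_dom y).
  by rewrite /= !resolventK.
have [bij cr] := rm.
have -> : T = fun x => (resolvent m%:C Ac (x, 0)).1.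
  apply/funext => x; rewrite (@resolventP _ _ _ _ bij (x, 0) (T x, 0))//.
    by split; [exact: resolvent_dom | exact: op_dom0].
  rewrite shift_complexifyE /= !scale0r scaler0 op_fun0 !subr0 addr0.
  by rewrite resolventK.
move=> x.
apply: (@continuous_comp X Y X (fun x => resolvent m%:C Ac (x, 0)) fst); last first.
  exact: cvg_fst.
apply: (@continuous_comp X Y Y (fun x => (x, 0)) (resolvent m%:C Ac)).
  by apply: cvg_pair; [exact: cvg_id | exact: cvg_cst].
exact: cr.
Qed.

Let bT := resolvent_blin.

Section Rotated.
Context (c d t : R).
Hypothesis t0 : t != 0.
Let l : R[i] := (m - c / t) +i* (- (d / t)).
Let L : Y -> Y := scalar_sub (rot_comp T c d) t.
Let Tc (z : Y) : complexification X := (T z.1, T z.2).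

Let Tc_dom z : op_dom Ac (Tc z).
Proof. by split; exact: resolvent_dom. Qed.

(** The identity behind the whole transfer: with [w = c + i d] and
    [l = m - w / t], [(l - A) T = (t - w T) / t] on the complexification. *)
Let shift_resolvent z : Defs.shift l Ac (Tc z) = t^-1 *: L z.
Proof.
have zE (V : zmodType) (a b e u : V) : a - b + e - (a - u) = u - (b - e).
  by rewrite !opprB [LHS]addrC -[a - b + e]addrA addrA subrK [e - b]addrC.
rewrite shift_complexifyE /= !op_resolvent; congr (_, _) => /=.
  rewrite scalerBl scaleNr opprK zE scalerBr scalerA mulVf// scale1r.
  by rewrite scalerBr !scalerA ![t^-1 * _]mulrC.
rewrite scalerBl scaleNr zE opprK scalerBr scalerA mulVf// scale1r.
by rewrite scalerDr !scalerA ![t^-1 * _]mulrC.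
Qed.

Let lL : linear L.
Proof. exact: scalar_sub_linear t (blin_linear (rot_comp_blin bT c d)). Qed.

Lemma rho_of_inverse : (exists S, inverse L S) -> rho A l.
Proof.
move=> [S [bS LS SL]].
have preim u : op_dom Ac u -> exists z, u = Tc z.
  case: u => u v [/= du dv]; exists (m *: u - A u, m *: v - A v).
  by rewrite /Tc /= !shiftK.
have bij : set_bij (op_dom Ac) setT (Defs.shift l Ac).
  split=> // [u v|f _].
    rewrite !inE => /preim[z ->] /preim[z' ->]; rewrite !shift_resolvent => e.
    congr Tc; apply: (can_inj LS); apply: (@scalerI _ _ t^-1) => //.
    by rewrite invr_eq0.
  exists (Tc (S (t *: (f : Y)))); first exact: Tc_dom.
  by rewrite shift_resolvent SL scalerA mulVf ?scale1r.
split=> //.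
have -> : resolvent l Ac = fun f => Tc (S (t *: (f : Y))).
  apply/funext => f; apply: (resolventP bij); first exact: Tc_dom.
  by rewrite shift_resolvent SL scalerA mulVf ?scale1r.
have cTc : continuous (Tc : Y -> Y).
  move=> z; apply: cvg_pair.
    by apply: continuous_comp; [exact: cvg_fst | exact: (blin_continuous bT)].
  by apply: continuous_comp; [exact: cvg_snd | exact: (blin_continuous bT)].
move=> f.
apply: (@continuous_comp Y Y Y (fun f => S (t *: f)) Tc); last exact: cTc.
apply: (@continuous_comp Y Y Y (fun f => t *: f) S); last exact: (blin_continuous bS).
by apply: cvgZl_tmp; exact: cvg_id.
Qed.

(** [G f] is in the domain, hence of the form [Tc (g f)], and [S f = g f / t]
    inverts [L].  The identity [t g f - w (G f) = t f] expresses [S] through [G],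
    which is continuous. *)
Lemma inverse_of_rho : rho A l -> exists S, inverse L S.
Proof.
move=> [bij cr]; pose G : Y -> Y := resolvent l Ac.
have lT := blin_linear bT.
have LE z : L z = t *: z - rot c d (Tc z) by [].
have injL z z' : L z = L z' -> z = z'.
  move=> zz'; have Tzz' : Tc z = Tc z'.
    apply: (shift_inj bij (Tc_dom z) (Tc_dom z')).
    by apply: etrans (shift_resolvent z) (etrans _ (esym (shift_resolvent z'))); rewrite zz'.
  by move: zz'; rewrite !LE Tzz' => /addIr /(scalerI t0).
have /choice[g gP] f : exists g, G f = Tc g /\ L g = t *: f.
  have [[d1 d2] Gf] := resolvent_domP bij f.
  pose g : Y := (m *: (G f).1 - A (G f).1, m *: (G f).2 - A (G f).2).
  have Gg : G f = Tc g by rewrite /Tc /g /= !shiftK//; case: (G f).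
  exists g; split=> //.
  apply: (@scalerI _ _ t^-1); first by rewrite invr_eq0.
  rewrite scalerA mulVf// scale1r.
  by apply: etrans (esym (shift_resolvent g)) _; rewrite -Gg.
pose S f := t^-1 *: g f.
have LS f : L (S f) = f by rewrite (linZ lL) (gP f).2 scalerA mulVf// scale1r.
have SE f : S f = t^-1 *: (f + t^-1 *: rot c d (G f)).
  congr (_ *: _); rewrite (gP f).1; have [_] := gP f; rewrite LE => /eqP.
  rewrite subr_eq => /eqP/(congr1 (fun z => t^-1 *: z)).
  by rewrite scalerDr !scalerA mulVf// !scale1r.
exists S; split=> //; last by move=> z; apply: injL; rewrite LS.
apply: continuous_blin.
  by move=> a x y; apply: injL; rewrite lL !LS.
have -> : S = fun f => t^-1 *: (f + t^-1 *: rot c d (G f)) by exact/funext.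
have crot : continuous (rot c d : Y -> Y).
  apply: (@blin_continuous R Y Y (rot_comp id c d)); apply: rot_comp_blin.
  by split=> //; exists 1 => x; rewrite mul1r.
move=> f; apply: cvgZl_tmp; apply: cvgD; first exact: cvg_id.
apply: cvgZl_tmp; apply: (@continuous_comp Y Y Y G (rot c d)); last exact: crot.
exact: cr.
Qed.

Lemma fredholm_rotated : fredholm (Defs.shift l Ac) -> fredholm_map L.
Proof.
move=> [[s kerE] [s' s'P]]; split.
  have [k kP] := complex_real_span s; exists k => z Lz; apply: kP.
  have kz : op_ker (Defs.shift l Ac) (Tc z).
    by split; [exact: Tc_dom | rewrite shift_resolvent Lz scaler0].
  have -> : (z : complexification X) = ((c / t) +i* (d / t)) *: Tc z.
    have /eqP := Lz; rewrite subr_eq0 => /eqP/(congr1 (fun z => t^-1 *: z)).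
    rewrite scalerA mulVf// scale1r => {1}->; congr (_, _) => /=.
      by rewrite scalerBr !scalerA ![t^-1 * _]mulrC.
    by rewrite scalerDr !scalerA ![t^-1 * _]mulrC.
  by apply: lin_spanZ; rewrite -kerE.
have [k kP] := complex_real_span s'; exists k => x.
have [_ [u [du1 du2] <-] su] := s'P x.
exists (t^-1 *: ((m *: u.1 - A u.1, m *: u.2 - A u.2) : Y)).
rewrite (linZ lL) -shift_resolvent; apply: kP.
by rewrite /Tc /= !shiftK//; move: su; case: (u).
Qed.

End Rotated.
End Bridge.

(** * The real part of the spectrum and the eigenvectors *)

Section RealParameter.
Context (R : realType) (X : completeNormedModType R) (T : X -> X) (t : R).
Hypothesis bT : blin T.
Local Notation Y := (X * X)%type.

Lemma scalar_sub_rot10 (z : Y) : scalar_sub (rot_comp T 1 0) t z =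
  (scalar_sub T t z.1, scalar_sub T t z.2).
Proof.
by rewrite /scalar_sub /rot_comp /rot !scale1r !scale0r subr0 addr0; case: z.
Qed.

Lemma inverse_rot10 : (exists S, inverse (scalar_sub T t) S) <->
  exists S : Y -> Y, inverse (scalar_sub (rot_comp T 1 0) t) S.
Proof.
split=> [[S [bS SK KS]]|[S [bS SK KS]]].
  exists (fun z => (S z.1, S z.2)); split=> [|[x y]|[x y]]; last 2 first.
  - by rewrite scalar_sub_rot10 /= !SK.
  - by rewrite scalar_sub_rot10 /= !KS.
  apply: continuous_blin.
    by move=> a x y; rewrite /= !(blin_linear bS).
  move=> z; apply: cvg_pair.
    by apply: continuous_comp; [exact: cvg_fst | exact: (blin_continuous bS)].
  by apply: continuous_comp; [exact: cvg_snd | exact: (blin_continuous bS)].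
have L0 : scalar_sub T t 0 = 0.
  exact: lin0 (scalar_sub_linear t (blin_linear bT)).
exists (fun x => (S (x, 0)).1); split=> [|x|x].
- have [M M0 SM] := blin_bound bS; split.
    move=> a x y; have -> : (a *: x + y, 0) = a *: ((x, 0) : Y) + (y, 0).
      by congr (_, _); rewrite /= scaler0 addr0.
    by rewrite (blin_linear bS).
  exists M => x; rewrite (@le_trans _ _ `|S (x, 0)|)//.
    by rewrite [leRHS]prod_normE le_max lexx.
  by rewrite (le_trans (SM _))// ler_pM2l// prod_normE ge_max /= lexx normr0 normr_ge0.
- by have := SK (x, 0); rewrite scalar_sub_rot10 /= L0 => ->.
- by have := KS (x, 0); rewrite scalar_sub_rot10 => -[].
Qed.

Lemma fredholm_rot10 : fredholm_map (scalar_sub (rot_comp T 1 0) t : Y -> Y) ->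
  fredholm_map (scalar_sub T t).
Proof.
have l1 : linear (fst : Y -> X) by [].
have L0 : scalar_sub T t 0 = 0.
  exact: lin0 (scalar_sub_linear t (blin_linear bT)).
move=> [[s sP] [s' s'P]]; split; [exists (map fst s)|exists (map fst s')] => x.
  move=> Lx; apply: (lin_span_map l1 (z := (x, 0))); apply: sP.
  by rewrite scalar_sub_rot10 /= Lx L0.
have [y sy] := s'P (x, 0); exists y.1.
by have := lin_span_map l1 sy; rewrite scalar_sub_rot10.
Qed.

End RealParameter.

(** The invertibility of [t - T] is an open condition on [t]. *)
Lemma inverse_at_sup (R : realType) (V : completeNormedModType R) (T : V -> V)
    (E : set R) : blin T -> has_sup E ->
  (forall t, E t -> ~ exists S, inverse (scalar_sub T t) S) ->
  ~ exists S, inverse (scalar_sub T (sup E)) S.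
Proof.
move=> bT hE En [S SE].
have [M M0 SM] : exists2 M, 0 < M & bounded_by M S by apply: blin_bound; case: SE.
have M2 : 0 < (2 * M)^-1 by rewrite invr_gt0 mulr_gt0.
have [t Et tE] := sup_adherent M2 hE; apply: (En t) => //.
have tle : t <= sup E by apply: ub_le_sup => //; case: hE.
have [|S' S'E _] := scalar_sub_inverse_near bT (s := t) SE M0 SM.
  by rewrite ger0_norm ?subr_ge0//; lra.
by exists S'.
Qed.

Section RealSpectrum.
Context (R : realType) (X : completeNormedModType R) (P : set X) (A : operator X).
Hypotheses (hP : is_cone P) (tP : total_cone P).
Context (w s1 : R).
Hypothesis (posA : forall l : R, w < l -> rho A l%:C /\ positive_map P (resolvent l A)).
Hypothesis (fredA : forall l : R[i], s1 < complex.Re l ->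
  fredholm (Defs.shift l (complexify A))).

Lemma real_inverse (m t : R) : w < m -> t != 0 -> rho A (m - t^-1)%:C ->
  exists S, inverse (scalar_sub (resolvent m A) t) S.
Proof.
move=> wm t0 rl; have [rm _] := posA wm; apply/(inverse_rot10 _ (resolvent_blin rm)).
apply: (inverse_of_rho rm t0); rewrite mul0r oppr0 div1r; exact: rl.
Qed.

Lemma real_rho (m t : R) : w < m -> t != 0 ->
  (exists S, inverse (scalar_sub (resolvent m A) t) S) -> rho A (m - t^-1)%:C.
Proof.
move=> wm t0; have [rm _] := posA wm; move/(inverse_rot10 _ (resolvent_blin rm)).
by move/(rho_of_inverse rm t0); rewrite mul0r oppr0 div1r.
Qed.

(** With [w' = c + i d], the point [m - w' n] corresponds to [t - w' T] at
    [t = 1 / n], and the disc of radius [n] about [m] to the parameters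
    [t >= 1 / n].  If this disc contained no real spectrum, then
    [rotated_inverse] would apply at the last [r >= 1 / n] for which [r - w' T]
    is not invertible, and invert it. *)
Lemma real_spectrum_in_disc (m n c d : R) : w < m -> 0 < n -> c ^+ 2 + d ^+ 2 = 1 ->
  s1 < m - n -> ~ rho A ((m - c * n) +i* (- (d * n))) ->
  exists2 l : R, m - n <= l & ~ rho A l%:C.
Proof.
move=> wm n0 cd1 s1n nrho; apply: contrapT => nl.
have {}nl l : m - n <= l -> rho A l%:C.
  by move=> ml; apply: contrapT => nr; apply: nl; exists l.
have [rm posT] := posA wm; have bT := resolvent_blin rm.
set T := resolvent m A in bT posT.
pose L t : X * X -> X * X := scalar_sub (rot_comp T c d) t.
pose E : set R := [set t | n^-1 <= t /\ ~ exists S, inverse (L t) S].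
have ni : 0 < n^-1 by rewrite invr_gt0.
have En : E n^-1.
  split; first exact: lexx.
  move=> iL; apply: nrho.
  have ni0 : n^-1 != 0 by rewrite gt_eqF.
  have H := @rho_of_inverse R X A m rm c d n^-1 ni0 iL.
  by rewrite invrK in H.
clear nrho.
have bR := rot_comp_blin bT c d.
have hE : has_sup E.
  split; first by exists n^-1.
  have [M M0 RM] := blin_bound bR; exists (2 * M) => t [_ nt].
  rewrite leNgt; apply/negP => tM; apply: nt.
  by have [S SE _] := scalar_sub_inverse_large bR M0 RM (ltW tM); exists S.
set r := sup E.
have nr : n^-1 <= r by apply: ub_le_sup => //; case: hE.
have r0 : 0 < r by exact: lt_le_trans nr.
have nEr : ~ exists S, inverse (L r) S.
  by apply: inverse_at_sup => // t [].
apply: nEr; apply: (rotated_inverse hP tP bT posT cd1).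
- move=> t rt; have t0 : 0 < t by exact: lt_le_trans rt.
  apply: (real_inverse wm (lt0r_neq0 t0)); apply: nl.
  by rewrite lerD2l lerN2 invf_ple// (le_trans nr).
- move=> t rt; apply: contrapT => nt; have : t <= r.
    by apply: ub_le_sup; [case: hE | split=> //; rewrite (le_trans nr)// ltW].
  by rewrite leNgt rt.
- apply: (fredholm_rotated rm); first by rewrite gt_eqF.
  apply: fredA => /=; apply: (lt_le_trans s1n); rewrite lerD2l lerN2.
  have c1 : c <= 1 by nra.
  rewrite (@le_trans _ _ (r^-1))//; last by rewrite invf_ple.
  by rewrite ler_pdivrMr// mulVf ?gt_eqF.
Qed.

(** The radius [n] of the circle about [m] through [a + i b] exceeds [m - a] by
    about [b^2 / (2 (m - a))], which is small when [m] is large. *)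
Lemma far_center (a b e : R) : s1 < a -> 0 < e -> exists m n c d : R,
  [/\ w < m, 0 < n, c ^+ 2 + d ^+ 2 = 1, s1 < m - n /\ a - e <= m - n &
      a = m - c * n /\ b = - (d * n)].
Proof.
move=> s1a e0; pose e' := Num.min e ((a - s1) / 2).
have e'0 : 0 < e' by rewrite lt_min e0 divr_gt0// subr_gt0.
have e'e : e' <= e by rewrite ge_min lexx.
have e's : e' < a - s1.
  have : e' <= (a - s1) / 2 by rewrite ge_min lexx orbT.
  by lra.
pose m := Num.max (w + 1) (a + 1 + b ^+ 2 / (2 * e')).
have wm : w < m by rewrite lt_max ltrDl ltr01.
have b0 : 0 <= b ^+ 2 / (2 * e') by rewrite divr_ge0 ?sqr_ge0// mulr_ge0// ltW.
have ma : a + 1 + b ^+ 2 / (2 * e') <= m by rewrite le_max lexx orbT.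
have ma0 : 0 < m - a by lra.
pose n := Num.sqrt ((m - a) ^+ 2 + b ^+ 2).
have n0 : 0 < n by rewrite sqrtr_gt0 ltr_pwDl ?sqr_ge0// exprn_gt0.
have n2 : n ^+ 2 = (m - a) ^+ 2 + b ^+ 2 by rewrite sqr_sqrtr// addr_ge0 ?sqr_ge0.
have nle : n <= m - a + e'.
  rewrite -(@ler_pXn2r _ 2) ?nnegrE ?(ltW n0)//; last by lra.
  rewrite n2 [leRHS]sqrrD -addrA lerD2l.
  have : b ^+ 2 <= (m - a) * (2 * e').
    rewrite -ler_pdivrMr ?mulr_gt0//; lra.
  have := sqr_ge0 e'; rewrite mulr2n; lra.
exists m, n, ((m - a) / n), (- b / n); split=> //.
- by rewrite !expr_div_n sqrrN -mulrDl -n2 mulfV// gt_eqF// exprn_gt0.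
- by split; lra.
- by rewrite !divfK ?gt_eqF// opprB addrC subrK opprK.
Qed.

Lemma real_spectrum_near (l : R[i]) (e : R) : ~ rho A l -> s1 < complex.Re l -> 0 < e ->
  exists2 l' : R, complex.Re l - e <= l' & ~ rho A l'%:C.
Proof.
case: l => a b nl s1a e0.
have [m [n [c [d [wm n0 cd1 [s1n an] [aE bE]]]]]] := far_center b s1a e0.
have nl1 : ~ rho A ((m - c * n) +i* (- (d * n))) by rewrite -aE -bE; exact: nl.
have [l' l'm nl'] := real_spectrum_in_disc wm n0 cd1 s1n nl1.
by exists l'; [exact: le_trans l'm | exact: nl'].
Qed.

Hypothesis (nonempty : exists2 l : R[i], ~ rho A l & s1 < complex.Re l).

Let real_spectrum : set R := [set l | ~ rho A l%:C].

Lemma real_spectrum_has_sup : has_sup real_spectrum.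
Proof.
split; last first.
  exists w => l nl; rewrite leNgt; apply/negP => wl; apply: nl.
  exact: (posA wl).1.
have [l nl s1l] := nonempty.
by have [l' _ nl'] := real_spectrum_near nl s1l ltr01; exists l'.
Qed.

Let s := sup real_spectrum.

Lemma spectrum_le_sup (l : R[i]) : ~ rho A l -> complex.Re l <= s.
Proof.
move=> nl; have key l1 : ~ rho A l1 -> s1 < complex.Re l1 -> complex.Re l1 <= s.
  move=> nl1 s1l; apply/ler_addgt0Pr => e e0.
  have [l' ll' nl'] := real_spectrum_near nl1 s1l e0.
  have : l' <= s by apply: ub_le_sup => //; case: real_spectrum_has_sup.
  by lra.
have [l0 nl0 s1l0] := nonempty.
have [s1l|ls1] := ltP s1 (complex.Re l); first exact: key.
by rewrite (le_trans ls1)// (le_trans (ltW s1l0))// key.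
Qed.

Lemma sup_real_spectrum_gt : s1 < s.
Proof. by have [l nl s1l] := nonempty; rewrite (lt_le_trans s1l)// spectrum_le_sup. Qed.

Lemma sup_real_spectrum_le : s <= w.
Proof.
apply: ge_sup; first by case: real_spectrum_has_sup.
move=> l nl; rewrite leNgt; apply/negP => wl; apply: nl.
exact: (posA wl).1.
Qed.

Let m := w + 1.
Let wm : w < m. Proof. by rewrite ltrDl. Qed.
Let ms : 0 < m - s. Proof. by rewrite subr_gt0 (le_lt_trans sup_real_spectrum_le). Qed.
Let r := (m - s)^-1.
Let r0 : 0 < r. Proof. by rewrite invr_gt0. Qed.
Let rs : m - r^-1 = s. Proof. by rewrite invrK opprB addrC subrK. Qed.
Let T := resolvent m A.

(** Invertibility of [r - T] would persist for [1 / (m - l)] with [l] in the real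
    spectrum close to its supremum [s]. *)
Lemma not_inverse_at_sup : ~ exists S, inverse (scalar_sub T r) S.
Proof.
have bT := resolvent_blin (posA wm).1.
move=> [S SE].
have [M M0 SM] : exists2 M, 0 < M & bounded_by M S by apply: blin_bound; case: SE.
have d0 : 0 < (2 * M)^-1 * (m - s) ^+ 2.
  by rewrite mulr_gt0 ?invr_gt0 ?mulr_gt0 ?exprn_gt0.
have [l nl sl] := sup_adherent d0 real_spectrum_has_sup; rewrite -/s in sl.
have ls : l <= s by exact: (@spectrum_le_sup l%:C nl).
have ml : 0 < m - l by rewrite (lt_le_trans ms)// lerD2l lerN2.
apply: nl; have -> : l = m - ((m - l)^-1)^-1 by rewrite invrK opprB addrC subrK.
have ml0 : (m - l)^-1 != 0 by rewrite invr_eq0 gt_eqF.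
apply: (real_rho wm ml0).
have [|S' S'E _] := scalar_sub_inverse_near bT (s := (m - l)^-1) SE M0 SM; last by exists S'.
have -> : r - (m - l)^-1 = (s - l) / ((m - s) * (m - l)).
  by rewrite /r; field; rewrite !gt_eqF.
rewrite ger0_norm; last by rewrite divr_ge0 ?subr_ge0// mulr_ge0// ltW.
rewrite ler_pdivrMr ?mulr_gt0//.
rewrite (@le_trans _ _ ((2 * M)^-1 * (m - s) ^+ 2))//; first by lra.
have M2 : 0 <= (2 * M)^-1 by rewrite invr_ge0 mulr_ge0// ltW.
by rewrite (ler_wpM2l M2)// expr2 (ler_wpM2l (ltW ms))// lerD2l lerN2.
Qed.

Lemma sup_real_spectrum_mem : ~ rho A s%:C.
Proof.
by move=> rhos; apply: not_inverse_at_sup; apply: (real_inverse wm (lt0r_neq0 r0)); rewrite rs.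
Qed.

Lemma spectral_bound_sup : spectral_bound A = s%:E.
Proof.
apply/eqP; rewrite eq_le; apply/andP; split.
  by apply: ge_ereal_sup => _ [l nl <-]; rewrite lee_fin spectrum_le_sup.
by apply: ereal_sup_ubound; exists s%:C; first exact: sup_real_spectrum_mem.
Qed.

Lemma leading_coefficient : exists C : X -> X, [/\ blin C, preserves P C,
  forall x, T (C x) = r *: C x, forall x, C (T x) = r *: C x & exists2 x, P x & C x != 0].
Proof.
have [rm posT] := posA wm; have bT := resolvent_blin rm.
apply: (positive_leading_coefficient hP tP bT posT _ _ not_inverse_at_sup).
- move=> t rt; have t0 : 0 < t by exact: lt_trans rt.
  apply: (real_inverse wm (lt0r_neq0 t0)).
  apply: contrapT => nt; have {nt} : m - t^-1 <= s.
    by apply: (ub_le_sup real_spectrum_has_sup.2); exact: nt.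
  by rewrite -rs lerD2l lerN2 lef_pV2 ?posrE// leNgt rt.
- apply: (fredholm_rot10 bT); apply: (fredholm_rotated rm); first by rewrite gt_eqF.
  by apply: fredA; rewrite /= div1r rs; exact: sup_real_spectrum_gt.
Qed.

(** [T u = r u] with [r = 1 / (m - s)] means [A u = s u], and [C T = r C] makes
    [f o C] satisfy the adjoint relation. *)
Lemma positive_eigenvectors :
  [/\ op_eigenvalue (complexify A) s%:C,
      exists2 x : X, P x & op_eigenvector A s x &
      forall dA : densely_defined A,
        op_eigenvalue (complexify (dual_operator dA)) s%:C /\
        exists2 f : dual_space X, dual_cone P f & op_eigenvector (dual_operator dA) s f].
Proof.
have [rm _] := posA wm; have bT : blin T := resolvent_blin rm.
have [C [bC PC TC CT [x Px Cx]]] := leading_coefficient.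
have lC := blin_linear bC.
have u_eig : op_eigenvector A s (C x).
  have uE : C x = T (r^-1 *: C x).
    by rewrite (linZ (blin_linear bT)) TC scalerA mulVf ?scale1r// gt_eqF.
  split=> //; first by rewrite uE; exact: (resolvent_dom rm).
  rewrite {1}uE (op_resolvent rm) -/T -uE -scalerBl; congr (_ *: _).
  exact: rs.
have eig_cx (E : lmodType R) (B : operator E) v : op_eigenvector B s v ->
    op_eigenvalue (complexify B) s%:C.
  move=> [dv v0 Bv]; exists (v, 0); split.
  - by split=> //; exact: op_dom0.
  - by apply: contra v0 => /eqP[->].
  - congr (_, _) => /=; first by rewrite Bv scaler0 subr0.
    by rewrite op_fun0 scaler0 scale0r addr0.
split; [exact: eig_cx u_eig | by exists (C x) => //; exact: PC |].
move=> dA.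
have [|f [lf cf fP fy]] := cone_separation (y := C x) (is_cone_convex hP).
  move=> PN; move/eqP : Cx; apply; apply: is_cone_pointed hP _ PN; exact: PC.
have lfC : linear (f \o C : X -> R^o) by move=> a y z; rewrite /= lC lf.
have fun_fC : f \o C \in @is_functional R X.
  rewrite inE; split=> // y; apply: continuous_comp; first exact: (blin_continuous bC).
  exact: cf.
pose phi : dual_space X := Dual fun_fC.
have phi_eig : op_eigenvector (dual_operator dA) s phi.
  have adj u : op_dom A u -> phi (A u) = (s *: phi) u.
    move=> du; change (f (C (A u)) = s * f (C u)).
    have := CT (m *: u - A u); rewrite /T (shiftK rm du) (linB lC) (linZ lC).
    move/(congr1 (fun y => r^-1 *: y)); rewrite scalerA mulVf ?gt_eqF// scale1r.
    move=> e; have -> : C (A u) = s *: C u.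
      by rewrite -rs scalerBl e opprB addrC subrK.
    exact: (linZ lf).
  split.
  - by exists (s *: phi).
  - apply/eqP => /(congr1 (fun g : dual_space X => g x)) phix.
    by move: fy; rewrite [f _]phix ltxx.
  - exact: fnE.
split; first exact: eig_cx phi_eig.
by exists phi => // y Py; apply: fP; exact: PC.
Qed.

End RealSpectrum.

Theorem theorem5p2 (R : realType) (X : completeNormedModType R)
    (P : set X) (A : operator X) :
  is_cone P -> total_cone P -> resolvent_positive P A ->
  (essential_spectral_bound A < spectral_bound A)%E ->
  (spectral_bound A < +oo)%E /\
  exists2 s : R, spectral_bound A = s%:E &
    [/\ op_eigenvalue (complexify A) s%:C,
        exists2 x : X, P x & op_eigenvector A s x &
        forall dA : densely_defined A,
          op_eigenvalue (complexify (dual_operator dA)) s%:C /\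
          exists2 f : dual_space X, dual_cone P f & op_eigenvector (dual_operator dA) s f].
Proof.
move=> hP tP [w posA] /ereal_sup_gt[_ [l0 nl0 <-]] essl.
(* A real number is needed between the two bounds, and the essential spectrum
   may be empty. *)
have [s1 s1l ess1] : exists2 s1 : R, s1 < complex.Re l0 &
    (essential_spectral_bound A <= s1%:E)%E.
  case: (essential_spectral_bound A) essl => [s1||].
  - by rewrite lte_fin; exists s1.
  - by [].
  - by move=> _; exists (complex.Re l0 - 1); [rewrite gtrDl ltrN10 | exact: leNye].
have fredA (l : R[i]) : s1 < complex.Re l -> fredholm (Defs.shift l (complexify A)).
  move=> s1l'; apply: contrapT => nf; move: s1l'; apply/negP; rewrite -leNgt.
  rewrite -lee_fin (le_trans _ ess1)//.
  by apply: ereal_sup_ubound; exists l.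
have ne : exists2 l : R[i], ~ rho A l & s1 < complex.Re l by exists l0.
have sE := spectral_bound_sup hP tP posA fredA ne.
split; first by rewrite sE ltry.
by exists (sup [set l | ~ rho A l%:C]) => //; exact: (positive_eigenvectors hP tP posA fredA ne).
Qed.
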